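(* Let $m\ge 0$ and let $C\in\mathrm{Cat}(m,3)$ be a realizable Catalan state. Then $$C(A)=A^{a}(A^{-2}+A^{2})^{b}(A^{-4}+1+A^{4})^{c}$$ for some $a\in\mathbb{Z}$ and $b,c\in\mathbb{N}\cup\{0\}$ if $C$ is vertically decomposable, and $$C(A)=A^{a}(A^{-2}+A^{2})^{b}\,\frac{(A^{-2}+A^{2})^{2c}-1}{A^{-4}+1+A^{4}}$$ for some $a\in\mathbb{Z}$, $b\in\{0,1\}$, and $c\in\mathbb{N}$ if $C$ is vertically indecomposable.
   Context: $\mathbb{N}=\{1,2,\dots\}$. $\mathrm{Cat}(m,n)$ is the set of Catalan states: non-crossing perfect matchings, by arcs embedded in a rectangle, of $2(m+n)$ boundary points: $x_1,\dots,x_n$ on the top side (left to right), $x'_1,\dots,x'_n$ on the bottom side (left to right), $y_1,\dots,y_m$ on the left side and $y'_1,\dots,y'_m$ on the right side (both top to bottom). Coefficients. The $m\times n$ lattice crossing $L(m,n)$ is the grid of $m$ horizontal lines (joining $y_j$ to $y'_j$) and $n$ vertical lines (joining $x_i$ to $x'_i$). A Kauffman state $s$ assigns a marker $\pm1$ to each of the $mn$ crossings. A marker $+1$ smooths the crossing by joining its top half-edge to its right one and its left half-edge to its bottom one; a marker $-1$ joins top to left and bottom to right. Let $|D_s|$ be the number of closed components of the resulting diagram, and $C_s\in\mathrm{Cat}(m,n)$ the Catalan state obtained by discarding them. The coefficient of $C$ (its coefficient when $L(m,n)$ is expanded in the basis $\mathrm{Cat}(m,n)$ of the relative Kauffman bracket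 skein module) is $$C(A)=\sum_{s:\,C_s=C}A^{\#\{+1\text{ in }s\}-\#\{-1\text{ in }s\}}(-A^2-A^{-2})^{|D_s|}\in\mathbb{Z}[A^{\pm1}].$$ $C$ is realizable if $C=C_s$ for some $s$. Decomposability. For $0\le i\le m$ let $l^h_i$ be the horizontal line separating the top points and $y_1,\dots,y_i,y'_1,\dots,y'_i$ from the remaining boundary points; the geometric intersection number $\#(C\cap l^h_i)$ is the number of arcs of $C$ having exactly one end above $l^h_i$. $C\in\mathrm{Cat}(m,n)$ is vertically decomposable if $\#(C\cap l^h_i)=n$ for some $0\le i\le m$, and vertically indecomposable otherwise. *)

(* Defs.v *)
From mathcomp Require Import all_boot all_order all_algebra.

Set Implicit Arguments.
Unset Strict Implicit.
Unset Printing Implicit Defensive.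

Import GRing.Theory.

Local Open Scope ring_scope.

(* With 0-based indices, [inl (inl i)] is the top point x_{i+1}, [inl (inr i)]
   the bottom point x'_{i+1}, [inr (inl j)] the left point y_{j+1} and
   [inr (inr j)] the right point y'_{j+1}. *)
Definition bpoint (m n : nat) := ('I_n + 'I_n + ('I_m + 'I_m))%type.

(* Rank of a boundary point when the boundary of the rectangle is traversed
   clockwise from its top left corner: top side rightwards, right side
   downwards, bottom side leftwards, left side upwards. *)
Definition bpos m n (p : bpoint m n) : nat :=
  match p with
  | inl (inl i) => i
  | inr (inr j) => n + j
  | inl (inr i) => n + m + rev_ord i
  | inr (inl j) => n + m + n + rev_ord j
  end.

(* A perfect matching is encoded as the fixed-point free involution C sending
   each boundary point to the other end of its arc.  Two arcs with disjoint
   ends can be embedded disjointly in the rectangle iff their ends do not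
   interleave along the boundary. *)
Definition perfect_matching m n (C : {ffun bpoint m n -> bpoint m n}) : bool :=
  [forall p, (C p != p) && (C (C p) == p)].

Definition noncrossing m n (C : {ffun bpoint m n -> bpoint m n}) : bool :=
  [forall p, forall q, ~~ [&& bpos p < bpos q, bpos q < bpos (C p)
                             & bpos (C p) < bpos (C q)]%N].

Definition Cat m n : {set {ffun bpoint m n -> bpoint m n}} :=
  [set C | perfect_matching C && noncrossing C].

(* The crossings cut the m horizontal and n vertical lines of L(m,n) into
   segments: [hseg j k] is the k-th segment, from left to right, of the j-th
   horizontal line, and [vseg k i] the k-th segment, from top to bottom, of the
   i-th vertical line. *)
Definition segment (m n : nat) := ('I_m * 'I_n.+1 + 'I_m.+1 * 'I_n)%type.

Definition hseg m n (j : 'I_m) (k : 'I_n.+1) : segment m n := inl (j, k).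
Definition vseg m n (k : 'I_m.+1) (i : 'I_n) : segment m n := inr (k, i).

Definition crossing (m n : nat) := ('I_m * 'I_n)%type.

(* [lift ord0 k] is k + 1, and [widen_ord (leqnSn _) k] is k. *)
Definition top_half m n (c : crossing m n) : segment m n :=
  vseg (widen_ord (leqnSn m) c.1) c.2.
Definition bottom_half m n (c : crossing m n) : segment m n :=
  vseg (lift ord0 c.1) c.2.
Definition left_half m n (c : crossing m n) : segment m n :=
  hseg c.1 (widen_ord (leqnSn n) c.2).
Definition right_half m n (c : crossing m n) : segment m n :=
  hseg c.1 (lift ord0 c.2).

Definition end_segment m n (p : bpoint m n) : segment m n :=
  match p with
  | inl (inl i) => vseg ord0 i
  | inl (inr i) => vseg ord_max i
  | inr (inl j) => hseg j ord0
  | inr (inr j) => hseg j ord_max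
  end.

(* [true] stands for the marker +1 and [false] for the marker -1. *)
Definition kauffman_state (m n : nat) := {ffun crossing m n -> bool}.

Definition smoothing_arcs m n (s : kauffman_state m n) (c : crossing m n) :
    seq (segment m n * segment m n) :=
  if s c then [:: (top_half c, right_half c); (left_half c, bottom_half c)]
  else [:: (top_half c, left_half c); (bottom_half c, right_half c)].

Definition joined m n (s : kauffman_state m n) : rel (segment m n) :=
  [rel u v | [exists c, ((u, v) \in smoothing_arcs s c)
                     || ((v, u) \in smoothing_arcs s c)]].

(* The components of the smoothed diagram are the connected components of the
   graph [joined s]; the closed ones are those reaching no boundary point. *)
Definition closed_components m n (s : kauffman_state m n) : nat :=
  n_comp (joined s)
    [pred u | [forall p : bpoint m n, ~~ connect (joined s) (end_segment p) u]].

(* C_s = C *)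
Definition yields m n (s : kauffman_state m n)
    (C : {ffun bpoint m n -> bpoint m n}) : bool :=
  [forall p, forall q, (C p == q) ==
     (p != q) && connect (joined s) (end_segment p) (end_segment q)].

Definition realizable m n (C : {ffun bpoint m n -> bpoint m n}) : bool :=
  [exists s : kauffman_state m n, yields s C].

(* Z[A, A^-1] is identified with its image in its fraction field, the field of
   fractions of Z[A]. *)
Definition A : {fraction {poly int}} := tofrac 'X.

Definition coefficient m n (C : {ffun bpoint m n -> bpoint m n}) :
    {fraction {poly int}} :=
  \sum_(s : kauffman_state m n | yields s C)
     A ^ (#|[set c | s c]|%:Z - #|[set c | ~~ s c]|%:Z)
     * (- A ^+ 2 - A ^- 2) ^+ closed_components s.

(* The points above the line l^h_i. *)
Definition above m n (i : nat) (p : bpoint m n) : bool :=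
  match p with
  | inl (inl _) => true
  | inl (inr _) => false
  | inr (inl j) => (j < i)%N
  | inr (inr j) => (j < i)%N
  end.

(* An arc having exactly one end above l^h_i is counted through that end. *)
Definition hcut m n (C : {ffun bpoint m n -> bpoint m n}) (i : nat) : nat :=
  #|[set p | above i p && ~~ above i (C p)]|.

Definition vertically_decomposable m n
    (C : {ffun bpoint m n -> bpoint m n}) : bool :=
  [exists i : 'I_m.+1, hcut C i == n].

(* Main.v *)
(** Smooth the crossings of L(m,3) one by one, row by row, and let the bottom end
    of a vertical line and the right end of a horizontal line move along: a
    partially smoothed diagram is then a perfect matching of the boundary points,
    which starts as the set of the m + 3 lines and ends as C_s, and a closed
    component appears exactly when a marker -1 joins two ends that are already
    matched.  Hence C(A) is obtained by expanding crossing by crossing.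

    After k rows a matching that can still lead to C is known once one knows what
    the three vertical lines lead to.  If C has three cuts at level k there is one
    possibility; if it has one cut, with upper end u, the two lines not leading
    to u are either joined together (values alpha and beta) or lead to the ends
    of an arc of C (value sigma or tau according to its side of u).  A return on
    two vertical lines slides through a horizontal line (Reidemeister II), so,
    with d = A^-2 + A^2 and up to powers of A, alpha and beta do not change from
    a level to the previous one, whereas (sigma, tau) is replaced by
    (d tau + beta, tau) or (sigma, d sigma + alpha) according to the side on which
    C joins u.  Without three cuts below, alpha or beta vanishes and sigma and tau
    are 1 + d^2 + ... + d^(2(c-1)), up to a factor d; below three cuts
    alpha = beta = 0, and leaving three cuts for one contributes a factor such as
    (d^2 - 1) tau + alpha + d beta, again a product of powers of d and d^2 - 1. *)

Require Import Defs.
From mathcomp Require Import all_boot all_order all_algebra zify ring.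

Set Implicit Arguments.
Unset Strict Implicit.
Unset Printing Implicit Defensive.

Import GRing.Theory.

Local Open Scope ring_scope.

(** * Components by union-find *)

Section UnionFind.
Variable V : finType.
Implicit Types (lam : V -> V) (es : seq (V * V)).

Definition merge lam (a b : V) : V -> V :=
  fun z => if lam z == lam a then lam b else lam z.

Definition labels es lam : V -> V :=
  foldl (fun l e => merge l e.1 e.2) lam es.

Definition edge_rel es : rel V :=
  [rel u v | ((u, v) \in es) || ((v, u) \in es)].

Lemma labels_congr es lam u v :
  lam u = lam v -> labels es lam u = labels es lam v.
Proof.
by elim: es lam => //= e es IH lam uv; apply: IH; rewrite /merge uv.
Qed.

Lemma labels_edge es lam a b :
  (a, b) \in es -> labels es lam a = labels es lam b.
Proof.
elim: es lam => //= e es IH lam; rewrite inE => /predU1P[<- | /IH //].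
by apply: labels_congr; rewrite /merge eqxx; case: ifP => // /eqP.
Qed.

Lemma connect_edge_rel_sym es : connect_sym (edge_rel es).
Proof. by apply: sym_connect_sym => u v; rewrite /edge_rel /= orbC. Qed.

Lemma connect_label es es' lam u :
    {subset es' <= es} -> (forall v, connect (edge_rel es) v (lam v)) ->
  connect (edge_rel es) u (labels es' lam u).
Proof.
elim: es' lam => [|[a b] es' IH] lam sub con /=; first exact: con.
apply: IH => [e es'e | v]; first by apply: sub; rewrite inE es'e orbT.
rewrite /merge; case: eqP => // eq_va.
have ab : edge_rel es a b by rewrite /edge_rel /= sub // inE eqxx.
apply: connect_trans (con v) _; rewrite eq_va.
apply: (@connect_trans _ _ a); first by rewrite connect_edge_rel_sym.
exact: connect_trans (connect1 ab) (con b).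
Qed.

(** A label is always a vertex of the class that it marks, so equal labels give a path; conversely
    the two ends of a listed edge end up with one label. *)
Lemma connect_labels es u v :
  connect (edge_rel es) u v = (labels es id u == labels es id v).
Proof.
have con w : connect (edge_rel es) w (labels es id w).
  by apply: connect_label => // z; apply: connect0.
apply/idP/eqP => [/connectP[p] | eq_uv]; last first.
  by apply: connect_trans (con u) _; rewrite eq_uv connect_edge_rel_sym.
elim: p u => [u _ ->|w p IH u /= /andP[uw /IH{}IH] /IH <-] //.
by case/orP: uw => /labels_edge ->.
Qed.

(** Only the label of [a] can disappear, and it does unless the two classes already coincide.
    Counting labels thus detects closed components. *)
Lemma card_merge lam a b :
  (#|[set merge lam a b z | z : V]| + (lam a != lam b))%N
  = #|[set lam z | z : V]|.
Proof.
case: eqVneq => [eq_ab | neq_ab].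
  rewrite addn0; congr #|pred_of_set _|; apply: eq_imset => z.
  by rewrite /merge; case: eqP => // ->.
rewrite (cardsD1 (lam a) [set lam z | z : V]) imset_f // addnC.
congr (_ + #|pred_of_set _|)%N; apply/setP => w; rewrite !inE.
apply/imsetP/andP => [[z _ ->] | [w_a /imsetP[z _ w_z]]].
  rewrite /merge; case: (eqVneq (lam z) (lam a)) => [_|z_a]; split; rewrite ?imset_f //.
  by rewrite eq_sym.
by exists z; rewrite // /merge -w_z (negPf w_a).
Qed.

(** The state of a segment that no smoothed crossing has touched yet. *)
Definition isolated lam r := forall v, lam r = lam v -> r = v.

Lemma isolated_merge lam a b r :
  isolated lam r -> r != a -> r != b -> isolated (merge lam a b) r.
Proof.
move=> iso ra rb v; rewrite /merge.
case: eqP => [/iso/eqP | _]; first by rewrite (negPf ra).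
by case: eqP => // _ /iso/eqP; [rewrite (negPf rb) | move/eqP].
Qed.

End UnionFind.

(** * Smoothing one crossing *)

Section CrossingSteps.
Variable T : eqType.
Implicit Types (mu : T -> T) (a b : T).

Definition transp a b : T -> T :=
  fun z => if z == a then b else if z == b then a else z.

(** Here [a] is the current end of a horizontal line and [b] that of a vertical one. At a marker +1
    each strand turns into the direction of the other, so the ends only exchange names. *)
Definition plus_step a b mu : T -> T :=
  fun z => transp a b (mu (transp a b z)).

(** At a marker -1 the strands arriving at [a] and [b] are joined, so their partners become matched;
    the two outgoing half-edges, again named [a] and [b], start a new arc. *)
Definition minus_step a b mu : T -> T := fun z =>
  if z == a then b else if z == b then a else
  if mu z == a then mu b else if mu z == b then mu a else mu z.

Definition smooth (plus : bool) a b mu : T -> T :=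
  if plus then plus_step a b mu else minus_step a b mu.

Lemma transpK a b : involutive (transp a b).
Proof.
move=> z; rewrite /transp; case: (eqVneq z a) => [-> | za].
  by rewrite eqxx; case: eqVneq.
by case: (eqVneq z b) => [->|zb]; rewrite ?eqxx // (negPf za) (negPf zb).
Qed.

Definition matching mu := involutive mu /\ forall z, mu z != z.

Lemma plus_step_matching a b mu : matching mu -> matching (plus_step a b mu).
Proof.
case=> inv ff; split=> z; first by rewrite /plus_step transpK inv transpK.
by rewrite -(inj_eq (inv_inj (transpK a b))) transpK.
Qed.

Lemma minus_step_matching a b mu :
  a != b -> matching mu -> matching (minus_step a b mu).
Proof.
move=> ab [inv ff].
have swp x y : (mu x == y) = (x == mu y) by rewrite -(inj_eq (inv_inj inv)) inv.
split=> z; rewrite /minus_step.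
  case: (eqVneq z a) => [->|za]; first by rewrite eq_sym (negPf ab) eqxx.
  case: (eqVneq z b) => [->|zb]; first by rewrite eqxx.
  case: (eqVneq (mu z) a) => [mza|mza].
    have za' : mu a = z by rewrite -mza inv.
    have mba : mu b != a by rewrite swp eq_sym za'; apply: contra_neq zb.
    by rewrite (negPf mba) (negPf (ff b)) inv eq_sym (negPf ab) eqxx.
  case: (eqVneq (mu z) b) => [mzb|mzb].
    have zb' : mu b = z by rewrite -mzb inv.
    have mab : mu a != b by rewrite swp eq_sym zb'; apply: contra_neq za.
    by rewrite (negPf mab) (negPf (ff a)) inv eqxx.
  by rewrite (negPf mza) (negPf mzb) inv (negPf za) (negPf zb).
case: (eqVneq z a) => [->|za]; first by rewrite eq_sym.
case: (eqVneq z b) => [->|zb] //.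
case: (eqVneq (mu z) a) => [mza|mza].
  by apply/eqP => e; move: ab; rewrite -mza -e inv eqxx.
case: (eqVneq (mu z) b) => [mzb|mzb] //.
by apply/eqP => e; move: ab; rewrite -mzb -e inv eqxx.
Qed.

Lemma smooth_matching plus a b mu :
  a != b -> matching mu -> matching (smooth plus a b mu).
Proof.
case: plus => // ab; first exact: plus_step_matching.
exact: minus_step_matching.
Qed.

Lemma smooth_unmoved plus a b mu z :
    z != a -> z != b -> mu z != a -> mu z != b ->
  smooth plus a b mu z = mu z.
Proof.
rewrite /smooth /plus_step /minus_step /transp.
by case: plus; do 4![move=> /negPf ->].
Qed.

Variable V : finType.
Implicit Types (lam : V -> V) (pos : T -> V).

(* The ends [pos p] and [pos q] lie in the same class of [lam] exactly when [p]
   and [q] are equal or paired by [mu]. *)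
Definition tracks lam pos mu :=
  forall p q, (lam (pos p) == lam (pos q)) = (p == q) || (mu p == q).

Definition upd pos (b : T) (r : V) : T -> V :=
  fun p => if p == b then r else pos p.

(** The segment [r] is fresh, so putting it in the class of the end of [b] disturbs no other
    class. *)
Lemma tracks_extend lam pos mu (b : T) r :
    isolated lam r -> (forall p, pos p != r) -> tracks lam pos mu ->
  tracks (merge lam (pos b) r) (upd pos b r) mu.
Proof.
move=> iso fresh tr.
have nr p : (lam r == lam (pos p)) = false.
  by apply: contraNF (fresh p) => /eqP/iso ->.
pose g l := if l == lam (pos b) then lam r else l.
have lamE p : merge lam (pos b) r (upd pos b r p) = g (lam (pos p)).
  rewrite /merge /upd /g; case: (eqVneq p b) => [->|//].
  by rewrite nr eqxx.
move=> p q; rewrite !lamE -tr /g.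
case: (eqVneq (lam (pos p)) (lam (pos b))) => [->|pb].
  by case: (eqVneq (lam (pos q))); rewrite ?eqxx // nr eq_sym => /negPf ->.
by case: (eqVneq (lam (pos q))) => [->|//]; rewrite eq_sym nr (negPf pb).
Qed.

Lemma tracks_transp lam pos mu a b :
  tracks lam pos mu -> tracks lam (pos \o transp a b) (plus_step a b mu).
Proof.
move=> tr p q; rewrite /= tr (inj_eq (inv_inj (transpK a b))).
by rewrite -(inj_eq (inv_inj (transpK a b)) (mu _)) transpK.
Qed.

Lemma eq_tracks lam pos pos' mu :
  pos =1 pos' -> tracks lam pos mu -> tracks lam pos' mu.
Proof. by move=> eq tr p q; rewrite -!eq tr. Qed.

(** The strand at [b] is prolonged by [r] and the one at [a] by [d]; then the names of the two ends
    are exchanged. *)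
Lemma tracks_plus lam pos mu a b r d :
    a != b -> isolated lam r -> isolated lam d -> r != d ->
    (forall p, pos p != r) -> (forall p, pos p != d) -> tracks lam pos mu ->
  tracks (merge (merge lam (pos b) r) (pos a) d) (upd (upd pos a r) b d)
         (plus_step a b mu).
Proof.
move=> ab iso_r iso_d rd fresh_r fresh_d tr.
have iso_d' : isolated (merge lam (pos b) r) d.
  by apply: isolated_merge; rewrite // eq_sym.
have fresh_d' p : upd pos b r p != d by rewrite /upd; case: ifP.
have := tracks_extend a iso_d' fresh_d' (tracks_extend b iso_r fresh_r tr).
have -> : upd pos b r a = pos a by rewrite /upd (negPf ab).
move=> /(@tracks_transp _ _ _ a b).
apply: eq_tracks => p; rewrite /= /upd /transp.
case: (eqVneq p a) => [->|pa]; first by rewrite eqxx eq_sym !(negPf ab).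
by case: (eqVneq p b) => [|pb]; rewrite ?eqxx // (negPf pa) (negPf pb).
Qed.

(** Two independent effects: merging the old classes pairs the partners of [a] and [b], while [r]
    and [d] form a class of their own. If [a] and [b] were partners, their old class is left without
    any end. *)
Lemma tracks_minus lam pos mu a b r d :
    matching mu -> a != b -> isolated lam r -> isolated lam d -> r != d ->
    (forall p, pos p != r) -> (forall p, pos p != d) -> tracks lam pos mu ->
  tracks (merge (merge lam (pos b) (pos a)) d r) (upd (upd pos a r) b d)
         (minus_step a b mu).
Proof.
move=> [inv ff] ab iso_r iso_d rd fresh_r fresh_d tr.
have swp x y : (mu x == y) = (x == mu y) by rewrite -(inj_eq (inv_inj inv)) inv.
set lam1 := merge lam _ _; set lam2 := merge lam1 _ _.
have iso1_r : isolated lam1 r by apply: isolated_merge; rewrite // eq_sym.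
have iso1_d : isolated lam1 d by apply: isolated_merge; rewrite // eq_sym.
have lam2d : lam2 d = lam1 r by rewrite /lam2 /merge eqxx.
have lam2r : lam2 r = lam1 r by rewrite /lam2 /merge; case: ifP.
have lam2p p : lam2 (pos p) = lam1 (pos p).
  rewrite /lam2 /merge -/lam1; case: eqP => // /esym/iso1_d/esym/eqP.
  by rewrite (negPf (fresh_d p)).
have nr p : (lam1 r == lam1 (pos p)) = false.
  by apply: contraNF (fresh_r p) => /eqP/iso1_r ->.
move=> p q; rewrite /upd /minus_step.
case: (eqVneq p b) => [->|pb].
  rewrite [b == a]eq_sym (negPf ab) lam2d.
  case: (eqVneq q b) => [->|qb]; first by rewrite lam2d eqxx.
  by case: (eqVneq q a) => [_|qa]; rewrite ?lam2r ?eqxx // lam2p nr.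
case: (eqVneq p a) => [->|pa].
  rewrite lam2r; case: (eqVneq q b) => [->|qb]; first by rewrite lam2d eqxx orbT.
  case: (eqVneq q a) => [_|qa]; first by rewrite lam2r !eqxx.
  by rewrite lam2p nr.
rewrite lam2p; case: (eqVneq q b) => [->|qb].
  rewrite lam2d eq_sym nr (negPf pb).
  case: (eqVneq (mu p) a) => [mpa|mpa].
    by rewrite (negPf (ff b)).
  case: (eqVneq (mu p) b) => [mpb|mpb]; last by rewrite (negPf mpb).
  by rewrite swp -mpb inv eq_sym (negPf pa).
case: (eqVneq q a) => [->|qa].
  rewrite lam2r eq_sym nr (negPf pa).
  case: (eqVneq (mu p) a) => [mpa|mpa].
    by rewrite swp -mpa inv eq_sym (negPf pb).
  case: (eqVneq (mu p) b) => [mpb|mpb]; last by rewrite (negPf mpa).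
  by rewrite (negPf (ff a)).
rewrite lam2p /lam1 /merge !tr (negPf pb) (negPf qb) /=.
case: (eqVneq (mu p) b) => [mpb|mpb].
  have -> : (mu p == a) = false by rewrite mpb eq_sym (negPf ab).
  have mb : mu b = p by rewrite -mpb inv.
  case: (eqVneq (mu q) b) => [mqb|mqb].
    have -> : q = p by rewrite -mb -mqb inv.
    by rewrite !eqxx.
  have -> : (p == q) = false by apply: contraNF mqb => /eqP <-; rewrite mpb.
  by rewrite tr [a == q]eq_sym (negPf qa).
case: (eqVneq (mu p) a) => [mpa|mpa].
  case: (eqVneq (mu q) b) => [mqb|mqb].
    by rewrite tr mpa eqxx orbT -mqb inv eqxx orbT.
  by rewrite tr mpa [a == q]eq_sym (negPf qa) [mu b == q]eq_sym -swp (negPf mqb).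
case: (eqVneq (mu q) b) => [mqb|mqb]; rewrite !tr //.
rewrite (negPf pa) (negPf mpa) swp mqb (negPf pb) orbF.
by case: eqP => //= e; rewrite e mqb eqxx in mpb.
Qed.

End CrossingSteps.

(** * Counting components and pairs by labels *)

Lemma n_comp_labels (V : finType) (e : rel V) (a : pred V) (lam : V -> V) :
    connect e =2 (fun u v => lam u == lam v) ->
    (forall u v, connect e u v -> a u = a v) ->
  n_comp e a = #|[set lam z | z in a]|.
Proof.
move=> conE resp; have sym : connect_sym e by move=> u v; rewrite !conE eq_sym.
have -> : n_comp e a = #|[set lam z | z in [predI roots e & a]]|.
  rewrite card_in_imset // => u v; rewrite !inE.
  move=> /andP[/eqP ru _] /andP[/eqP rv _] /eqP.
  by rewrite -conE => /(fingraph.rootP sym); rewrite ru rv.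
congr #|pred_of_set _|; apply/setP => w; apply/imsetP/imsetP => -[z].
  by rewrite inE => /andP[_ az] ->; exists z.
move=> az ->; exists (fingraph.root e z).
  have ea : a z = a (fingraph.root e z) by apply/resp/connect_root.
  by apply/andP; split; [apply: roots_root | rewrite -topredE /= -ea].
by apply/eqP; rewrite -conE connect_root.
Qed.

Lemma card_pairs (T V : finType) (f : T -> V) mu : matching mu ->
    (forall p q, (f p == f q) = (p == q) || (mu p == q)) ->
  #|T| = (2 * #|[set f p | p : T]|)%N.
Proof.
move=> [_ ff] fE; transitivity (\sum_(p : T) 1)%N; first by rewrite sum1_card.
rewrite (partition_big_imset f) /= mulnC -sum_nat_const.
apply: eq_bigr => v /imsetP[p _ ->]; rewrite sum1dep_card.
have -> : [set q | f q == f p] = [set p; mu p].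
  by apply/setP => q; rewrite !inE eq_sym fE ![_ == q]eq_sym.
by rewrite cards2 eq_sym ff.
Qed.

(** * Smoothing the whole lattice *)

Section Tracing.
Variables m n : nat.
Notation T := (bpoint m n).
Notation V := (segment m n).
Implicit Types (mu : T -> T) (lam : V -> V) (s : kauffman_state m n).
Implicit Types (c : crossing m n) (cs : seq (crossing m n)).

Definition xtop (i : 'I_n) : T := inl (inl i).
Definition xbot (i : 'I_n) : T := inl (inr i).
Definition yleft (j : 'I_m) : T := inr (inl j).
Definition yright (j : 'I_m) : T := inr (inr j).

Definition lines (p : T) : T :=
  match p with
  | inl (inl i) => xbot i
  | inl (inr i) => xtop i
  | inr (inl j) => yright j
  | inr (inr j) => yleft j
  end.

(* While the crossings are smoothed one by one, row by row, the bottom end of a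
   vertical line and the right end of a horizontal line stand for the point
   that these lines have reached so far. *)
Definition step s c mu : T -> T :=
  smooth (s c) (yright c.1) (xbot c.2) mu.

Definition loop s c mu : bool := ~~ s c && (mu (yright c.1) == xbot c.2).

Definition run s cs mu : T -> T := foldl (fun nu c => step s c nu) mu cs.

Fixpoint loops s cs mu : nat :=
  if cs is c :: cs' then (loop s c mu + loops s cs' (step s c mu))%N else 0.

Definition row_crossings (j : 'I_m) : seq (crossing m n) :=
  [seq (j, i) | i <- enum 'I_n].

Definition crossings_from (k : nat) : seq (crossing m n) :=
  flatten [seq row_crossings j | j <- drop k (enum 'I_m)].

Definition arcs s cs := flatten [seq smoothing_arcs s c | c <- cs].

Lemma lines_matching : matching lines.
Proof. by split; case=> [] []. Qed.

Lemma step_matching s c mu : matching mu -> matching (step s c mu).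
Proof. exact: smooth_matching. Qed.

Lemma run_cat s cs cs' mu : run s (cs ++ cs') mu = run s cs' (run s cs mu).
Proof. exact: foldl_cat. Qed.

Lemma loops_cat s cs cs' mu :
  loops s (cs ++ cs') mu = (loops s cs mu + loops s cs' (run s cs mu))%N.
Proof. by elim: cs mu => //= c cs IH mu; rewrite IH addnA. Qed.

Lemma labels_cat es es' lam : labels (es ++ es') lam = labels es' (labels es lam).
Proof. exact: foldl_cat. Qed.

Lemma arcs_cat s cs cs' : arcs s (cs ++ cs') = arcs s cs ++ arcs s cs'.
Proof. by rewrite /arcs map_cat flatten_cat. Qed.

Lemma enum_ord_drop k q (lt_kq : (k < q)%N) :
  drop k (enum 'I_q) = Ordinal lt_kq :: drop k.+1 (enum 'I_q).
Proof.
rewrite (drop_nth (Ordinal lt_kq)) ?size_enum_ord //; congr (_ :: _).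
by apply: val_inj; rewrite /= nth_enum_ord.
Qed.

Lemma crossings_fromS k (lt_km : (k < m)%N) :
  crossings_from k = row_crossings (Ordinal lt_km) ++ crossings_from k.+1.
Proof. by rewrite /crossings_from (enum_ord_drop lt_km). Qed.

Lemma crossings_from_end : crossings_from m = [::].
Proof. by rewrite /crossings_from drop_oversize ?size_enum_ord. Qed.

(* [hreach j i] and [vreach j i] tell how far the horizontal and the vertical
   lines have been followed when the crossings before [(j, i)] are smoothed. *)
Definition hreach (j i : nat) (j' : 'I_m) : nat :=
  if (j' < j)%N then n else if j' == j :> nat then i else 0.
Definition vreach (j i : nat) (i' : 'I_n) : nat := (j + (i' < i))%N.

Definition reach j i (p : T) : V :=
  match p with
  | inl (inl _) | inr (inl _) => end_segment p
  | inl (inr i') => vseg (inord (vreach j i i')) i'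
  | inr (inr j') => hseg j' (inord (hreach j i j'))
  end.

Definition beyond j i (u : V) : bool :=
  match u with
  | inl (j', k) => (hreach j i j' < k)%N
  | inr (k, i') => (vreach j i i' < k)%N
  end.

(** The invariant just before the crossing [(j, i)] is smoothed; isolation of the segments ahead
    makes the next two half-edges fresh. *)
Definition traced j i lam mu :=
  [/\ matching mu, tracks lam (reach j i) mu
    & forall u, beyond j i u -> isolated lam u].

Lemma vreach_le j i i' : (j < m)%N -> (vreach j i i' <= m)%N.
Proof. by rewrite /vreach; case: (i' < i)%N; rewrite ?addn0 ?addn1 // => /ltnW. Qed.

Lemma hreach_le j i j' : (i <= n)%N -> (hreach j i j' <= n)%N.
Proof. by rewrite /hreach; case: ifP => // _; case: ifP. Qed.

Lemma reach_beyond j i p u :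
  (j < m)%N -> (i <= n)%N -> beyond j i u -> reach j i p != u.
Proof.
move=> jm le_in; apply: contraTneq => <-; rewrite /beyond.
case: p => [] [] k /=; rewrite -?leqNgt //.
  by rewrite inordK // ltnS vreach_le.
by rewrite inordK // ltnS hreach_le.
Qed.

Lemma left_half_reach (j : 'I_m) (i : 'I_n) :
  left_half (j, i) = reach j i (yright j).
Proof.
congr (hseg _ _); apply: val_inj; rewrite /= /hreach ltnn eqxx.
by rewrite inordK // ltnS ltnW.
Qed.

Lemma top_half_reach (j : 'I_m) (i : 'I_n) :
  top_half (j, i) = reach j i (xbot i).
Proof.
congr (vseg _ _); apply: val_inj; rewrite /= /vreach ltnn addn0.
by rewrite inordK // ltnS ltnW.
Qed.

Lemma beyond_right (j : 'I_m) (i : 'I_n) : beyond j i (right_half (j, i)).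
Proof. by rewrite /= /hreach ltnn eqxx /bump /= add1n. Qed.

Lemma beyond_bottom (j : 'I_m) (i : 'I_n) : beyond j i (bottom_half (j, i)).
Proof. by rewrite /= /vreach ltnn addn0 /bump /= add1n. Qed.

Lemma beyondS (j : 'I_m) (i : 'I_n) u : beyond j i.+1 u ->
  [/\ beyond j i u, u != right_half (j, i) & u != bottom_half (j, i)].
Proof.
case: u => [[j' k]|[k i']] /=; rewrite /right_half /bottom_half /hseg /vseg /=.
  rewrite /hreach; case: ifP => [lt|_].
    by move=> lt_nk; have := ltn_ord k; rewrite ltnS leqNgt lt_nk.
  case: (eqVneq (j' : nat) j) => [e|ne] lt_k.
    split=> //; first exact: ltnW.
    apply: contraTneq lt_k => -[_ ->]; rewrite -leqNgt /bump //.
  split=> //; apply: contraNneq ne => -[-> _] //.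
rewrite /vreach ltnS => lt_k; split=> //.
  apply: leq_ltn_trans lt_k; rewrite leq_add2l.
  by case: (ltnP i' i) => // /ltnW ->.
apply: contraTneq lt_k => -[-> ->].
by rewrite leqnn addn1 -leqNgt /bump.
Qed.

Lemma reachS (j : 'I_m) (i : 'I_n) :
  upd (upd (reach j i) (yright j) (right_half (j, i))) (xbot i)
      (bottom_half (j, i)) =1 reach j i.+1.
Proof.
case=> [] [] k; rewrite /upd //=.
  case: (eqVneq (inl (inr k) : T) (xbot i)) => [[->]|ne].
    congr (vseg _ _); apply: val_inj.
    by rewrite /= /vreach ltnS leqnn inordK /bump /= ?add1n addn1 ?ltnS.
  congr (vseg _ _); congr inord; rewrite /vreach ltnS [(k <= i)%N]leq_eqVlt.
  by have -> // : (k == i :> nat) = false;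
    apply: contraNF ne => /eqP/val_inj ->.
case: (eqVneq (inr (inr k) : T) (yright j)) => [[->]|ne].
  congr (hseg _ _); apply: val_inj.
  by rewrite /= /hreach ltnn eqxx inordK /bump /= ?add1n ?ltnS.
congr (hseg _ _); congr inord; rewrite /hreach.
by have -> // : (k == j :> nat) = false; apply: contraNF ne => /eqP/val_inj ->.
Qed.

Lemma right_neq_bottom c : right_half c != bottom_half c.
Proof. by []. Qed.

(** A crossing performs two merges, so two classes are lost unless a merge is void, which happens
    exactly when a closed component appears. *)
Lemma traced_step s (j : 'I_m) (i : 'I_n) lam mu :
    traced j i lam mu ->
  traced j i.+1 (labels (smoothing_arcs s (j, i)) lam) (step s (j, i) mu)
  /\ (#|[set labels (smoothing_arcs s (j, i)) lam z | z : V]| + 2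
      = #|[set lam z | z : V]| + loop s (j, i) mu)%N.
Proof.
move=> [mat tr iso].
have le_in : (i <= n)%N by apply: ltnW.
have iso_r := iso _ (beyond_right j i); have iso_d := iso _ (beyond_bottom j i).
have rd := right_neq_bottom (j, i).
have fr p := reach_beyond p (ltn_ord j) le_in (beyond_right j i).
have fd p := reach_beyond p (ltn_ord j) le_in (beyond_bottom j i).
have isoN u p : isolated lam u -> reach j i p != u -> lam (reach j i p) != lam u.
  by move=> iu; apply: contra_neq => /esym/iu ->.
have iso2 u a b a' b' : isolated lam u ->
    [/\ u != a, u != b, u != a' & u != b'] ->
    isolated (merge (merge lam a b) a' b') u.
  by move=> iu [*]; apply: isolated_merge => //; apply: isolated_merge.
split.
  split; first exact: step_matching.
    apply: eq_tracks (reachS j i) _; rewrite /step /smoothing_arcs.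
    case: (s (j, i)); rewrite /labels /= left_half_reach top_half_reach.
      exact: tracks_plus.
    exact: tracks_minus.
  move=> u /beyondS[bu ur ud]; rewrite /smoothing_arcs.
  have fu p : u != reach j i p by rewrite eq_sym reach_beyond.
  case: (s (j, i)); rewrite /labels /= left_half_reach top_half_reach;
    by apply: iso2 => //; apply: iso.
rewrite /loop /smoothing_arcs; case: (s (j, i)) => /=.
  (* Both merges of a marker +1 absorb an isolated segment, hence are effective. *)
  rewrite addn0 -(card_merge lam (top_half (j, i)) (right_half (j, i))).
  rewrite -(card_merge _ (left_half (j, i)) (bottom_half (j, i))) -addnA.
  congr (_ + _)%N; rewrite left_half_reach top_half_reach isoN //.
  set lam1 := merge lam _ _.
  have iso1 : isolated lam1 (bottom_half (j, i)).
    by apply: isolated_merge; rewrite // eq_sym.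
  by case: eqP => // /esym/iso1/eqP; rewrite eq_sym (negPf (fd _)).
(* The first merge of a marker -1 is void exactly when the two ends are already matched; the second
   joins two isolated segments. *)
rewrite -(card_merge lam (top_half (j, i)) (left_half (j, i))).
rewrite -(card_merge _ (bottom_half (j, i)) (right_half (j, i))) -!addnA.
congr (_ + _)%N; rewrite left_half_reach top_half_reach tr.
have -> : (xbot i == yright j) = false by [].
have [inv _] := mat.
rewrite -(inj_eq (inv_inj inv)) inv [xbot i == _]eq_sym.
set lam1 := merge lam _ _.
have iso1 : isolated lam1 (right_half (j, i)).
  by apply: isolated_merge; rewrite // eq_sym.
have -> : lam1 (bottom_half (j, i)) != lam1 (right_half (j, i)).
  by apply/eqP => /esym/iso1/eqP; rewrite (negPf rd).
by case: eqP.
Qed.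

Definition fused lam : nat := #|[set lam z | z : V]|.

Lemma traced_row s (j : 'I_m) lam mu :
    traced j 0 lam mu ->
  traced j n (labels (arcs s (row_crossings j)) lam) (run s (row_crossings j) mu)
  /\ (fused (labels (arcs s (row_crossings j)) lam) + 2 * size (row_crossings j)
      = fused lam + loops s (row_crossings j) mu)%N.
Proof.
pose tail i := [seq (j, i') | i' <- drop i (enum 'I_n)].
suff suf d i lam' mu' : (i + d = n)%N -> traced j i lam' mu' ->
    traced j n (labels (arcs s (tail i)) lam') (run s (tail i) mu')
    /\ (fused (labels (arcs s (tail i)) lam') + 2 * size (tail i)
        = fused lam' + loops s (tail i) mu')%N.
  by move=> tr; have := suf n 0 lam mu erefl tr; rewrite /tail drop0.
elim: d => [|d IH] in i lam' mu' *.
  rewrite addn0 => -> tr.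
  by rewrite /tail drop_oversize ?size_enum_ord //= muln0 !addn0.
rewrite addnS => e; have lt_in : (i < n)%N by rewrite -e ltnS leq_addr.
rewrite /tail (enum_ord_drop lt_in) -/(tail i.+1) map_cons -/(tail i.+1).
move=> /(traced_step s (i := Ordinal lt_in))[tr cnt].
have [tr' cnt'] := IH i.+1 _ _ e tr.
rewrite /arcs map_cons [flatten _]/= labels_cat -/(arcs s _); split=> //.
by move: cnt cnt'; rewrite /fused /=; lia.
Qed.

Lemma traced_next (j : 'I_m) lam mu :
  traced j n lam mu -> traced j.+1 0 lam mu.
Proof.
have hE j' : hreach j.+1 0 j' = hreach j n j'.
  rewrite /hreach ltnS leq_eqVlt; case: (eqVneq (j' : nat) j) => [->|_] /=.
    by rewrite ltnn.
  by case: ifP => // _; case: ifP.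
have vE i : vreach j.+1 0 i = vreach j n i.
  by rewrite /vreach ltn_ord addn0 addn1.
case=> mat tr iso; split=> // [|u].
  by apply: eq_tracks tr => -[] [] k //=; rewrite ?hE ?vE.
by case: u => [[j' k]|[k i]] /=; rewrite ?hE ?vE => b; apply: iso.
Qed.

Lemma traced_rows s k lam mu : (k <= m)%N -> traced k 0 lam mu ->
  traced m 0 (labels (arcs s (crossings_from k)) lam) (run s (crossings_from k) mu)
  /\ (fused (labels (arcs s (crossings_from k)) lam) + 2 * size (crossings_from k)
      = fused lam + loops s (crossings_from k) mu)%N.
Proof.
move/subnKC; move: (m - k)%N => d.
elim: d k lam mu => [|d IH] k lam mu.
  by rewrite addn0 => -> tr; rewrite crossings_from_end muln0 !addn0.
rewrite addnS => e; have lt_km : (k < m)%N by rewrite -e ltnS leq_addr.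
rewrite (crossings_fromS lt_km) => /(traced_row s (j := Ordinal lt_km)).
move=> [/traced_next tr cnt]; have [tr' cnt'] := IH k.+1 _ _ e tr.
rewrite arcs_cat labels_cat run_cat loops_cat size_cat mulnDr; split=> //.
by move: cnt cnt'; lia.
Qed.

Lemma traced_lines : traced 0 0 id lines.
Proof.
split=> [||u _ v]; [exact: lines_matching | | by []].
have inj k : hreach 0 0 k = 0%N by rewrite /hreach; case: ifP.
have e0 q : inord 0 = ord0 :> 'I_q.+1 by apply: val_inj; rewrite /= inordK.
case=> [] [] i [] [] i' //=; rewrite ?inj /vreach ?ltn0 ?addn0 ?e0 //.
- by apply/eqP/orP => [[->]|[/eqP[->]|//]]; first by left.
- by apply/eqP/orP => [[->]|[/eqP[->]|//]]; first by left.
- by apply/eqP/eqP => -[->].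
by apply/eqP/eqP => -[->].
Qed.

Lemma size_crossings : size (crossings_from 0) = (m * n)%N.
Proof.
rewrite /crossings_from drop0 size_flatten /shape -map_comp.
rewrite sumnE big_map (eq_bigr (fun=> n)) => [|j _]; last first.
  by rewrite /= size_map size_enum_ord.
by rewrite big_enum /= sum_nat_const card_ord.
Qed.

Lemma mem_crossings c : c \in crossings_from 0.
Proof.
case: c => j i; rewrite /crossings_from drop0; apply/flatten_mapP.
by exists j; rewrite ?mem_enum // map_f ?mem_enum.
Qed.

Lemma le_crossings_from k c :
  c \in crossings_from k -> (k <= c.1)%N.
Proof.
case/flatten_mapP=> j jk /mapP[i _ ->] /=.
have : val j \in map val (drop k (enum 'I_m)) by rewrite map_f.
by rewrite map_drop val_enum_ord drop_iota mem_iota add0n => /andP[].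
Qed.

Lemma joined_arcs s : joined s =2 edge_rel (arcs s (crossings_from 0)).
Proof.
move=> u v; apply/existsP/orP => [[c /orP[]] uv | [] /flatten_mapP[c _ uv]].
- by left; apply/flatten_mapP; exists c; rewrite ?mem_crossings.
- by right; apply/flatten_mapP; exists c; rewrite ?mem_crossings.
- by exists c; rewrite uv.
by exists c; rewrite uv orbT.
Qed.

Lemma reach_end p : reach m 0 p = end_segment p.
Proof.
case: p => [] [] k //=; first congr (vseg _ _); last congr (hseg _ _);
  by apply: val_inj; rewrite /= /hreach /vreach ?ltn_ord ?ltn0 ?addn0 inordK.
Qed.

(** After the last row the reached segments are the boundary segments. Closed components are counted
    by difference: there are [m (n+1) + (m+1) n] segments, each of the [m n] crossings removes two
    classes up to loops, and [m + n] classes contain boundary points. *)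
Theorem trace_state s :
  [/\ matching (run s (crossings_from 0) lines),
      forall p q, connect (joined s) (end_segment p) (end_segment q)
                  = (p == q) || (run s (crossings_from 0) lines p == q)
    & closed_components s = loops s (crossings_from 0) lines].
Proof.
have [[mat tr _] cnt] := traced_rows s (leq0n m) traced_lines.
set mu := run _ _ _ in mat tr *; set lam := labels _ _ in tr cnt.
have conE : connect (joined s) =2 (fun u v => lam u == lam v).
  by move=> u v; rewrite (eq_connect (joined_arcs s)) connect_labels.
have trE p q : (lam (end_segment p) == lam (end_segment q))
    = (p == q) || (mu p == q) by rewrite -tr !reach_end.
split=> // [p q|]; first by rewrite conE.
have esym : connect_sym (joined s) by move=> u v; rewrite !conE eq_sym.
rewrite /closed_components; set a := [pred u | _].
rewrite (n_comp_labels conE) => [|u v uv]; last first.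
  apply: eq_forallb => p; congr (~~ _); exact: (same_connect_r esym uv).
have splitV : (#|[set lam z | z in a]| + #|[set lam (end_segment p) | p : T]|
    = fused lam)%N.
  rewrite /fused -cardsUI; set I := _ :&: _; have -> : I = set0.
    apply/setP => w; rewrite !inE; apply/negP => /andP[/imsetP[z az ->]].
    case/imsetP => p _ /eqP; rewrite eq_sym -conE.
    by move/forallP: az => /(_ p)/negPf ->.
  rewrite cards0 addn0; congr #|pred_of_set _|; apply/setP => w; rewrite inE.
  apply/orP/imsetP => [[/imsetP[z _ ->]|/imsetP[p _ ->]]|[z _ ->]];
    [by exists z | by exists (end_segment p) | ].
  have [az|] := boolP (z \in a); first by left; apply: imset_f.
  rewrite inE negb_forall => az; right; move: az => /existsP[p].
  rewrite negbK conE => /eqP <-.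
  exact: imset_f.
have := card_pairs (f := lam \o end_segment (n := n)) mat trE.
rewrite !card_sum !card_ord !addnn -doubleD -mul2n => /eqP.
rewrite eqn_pmul2l // => /eqP ends.
have idV : fused id = #|{: V}|.
  rewrite -cardsT; congr #|pred_of_set _|; apply/setP => z; rewrite inE.
  by apply/imsetP; exists z.
move: cnt; rewrite -splitV -ends size_crossings idV.
rewrite card_sum !card_prod !card_ord mulnS [(m.+1 * n)%N]mulSn.
move: (m * n)%N => q; set u := #|_|; set v := loops _ _ _; clearbody u v.
by lia.
Qed.

Lemma yieldsE s (C : {ffun T -> T}) :
  yields s C = [forall p, run s (crossings_from 0) lines p == C p].
Proof.
have [[inv ff] con _] := trace_state s.
apply/forallP/forallP => [H p | H p].
  have /forallP/(_ (run s (crossings_from 0) lines p))/eqP := H p.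
  by rewrite con eqxx orbT [p == _]eq_sym ff eq_sym => ->.
apply/forallP => q; rewrite con -(eqP (H p)).
by case: (eqVneq p q) => [<-|_] /=; rewrite ?(negPf (ff p)).
Qed.

End Tracing.

Arguments xtop {m n} i.
Arguments xbot {m n} i.
Arguments yleft {m n} j.
Arguments yright {m n} j.
Arguments lines {m n} p.
Arguments row_crossings {m n} j.
Arguments crossings_from {m n} k.

(** * The skein expansion *)

Section Expansion.
Variables (m n : nat) (R : comNzSemiRingType) (p q dl : R).
Notation T := (bpoint m n).
Variable C : {ffun T -> T}.
Implicit Types (mu : T -> T) (s : kauffman_state m n).
Implicit Types (c : crossing m n) (cs : seq (crossing m n)).

(* The skein expansion along the crossings of [cs], with weight [p] for a
   marker +1, [q] for a marker -1 and [dl] for a closed component. *)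
Fixpoint skein cs mu : R :=
  if cs is c :: cs' then
    p * skein cs' (smooth true (yright c.1) (xbot c.2) mu)
    + q * dl ^+ (mu (yright c.1) == xbot c.2)
        * skein cs' (smooth false (yright c.1) (xbot c.2) mu)
  else [forall z, mu z == C z]%:R.

Definition marker s c : R := if s c then p else q.

Definition state_weight s cs mu : R :=
  (\prod_(c <- cs) marker s c) * dl ^+ loops s cs mu
  * [forall z, run s cs mu z == C z]%:R.

Lemma state_weight_cons s c cs mu :
  state_weight s (c :: cs) mu
  = marker s c * dl ^+ loop s c mu * state_weight s cs (step s c mu).
Proof. by rewrite /state_weight big_cons /= exprD mulrACA !mulrA. Qed.

Lemma run_ext s s' cs mu : {in cs, s =1 s'} -> run s cs mu = run s' cs mu.
Proof.
elim: cs mu => //= c cs IH mu ss'; rewrite /step (ss' c) ?mem_head //.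
by apply: IH => c' cc'; rewrite ss' // inE cc' orbT.
Qed.

Lemma loops_ext s s' cs mu : {in cs, s =1 s'} -> loops s cs mu = loops s' cs mu.
Proof.
elim: cs mu => //= c cs IH mu ss'; rewrite /step /loop (ss' c) ?mem_head //.
by congr (_ + _)%N; apply: IH => c' cc'; rewrite ss' // inE cc' orbT.
Qed.

Lemma state_weight_ext s s' cs mu :
  {in cs, s =1 s'} -> state_weight s cs mu = state_weight s' cs mu.
Proof.
move=> ss'; rewrite /state_weight (run_ext _ ss') (loops_ext _ ss').
by congr (_ * _ * _); apply: eq_big_seq => c /ss'; rewrite /marker => ->.
Qed.

(** Fixing the marker -1 outside [cs] makes every choice of markers on [cs] occur exactly once. *)
Definition positive_within cs s := [forall c, (c \in cs) || ~~ s c].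

Lemma skein_sum cs mu : uniq cs ->
  \sum_(s : kauffman_state m n | positive_within cs s) state_weight s cs mu
  = skein cs mu.
Proof.
elim: cs mu => [|c cs IH] mu /=.
  move=> _; pose s0 : kauffman_state m n := [ffun=> false].
  rewrite (big_pred1 s0) => [|s]; first by rewrite /state_weight big_nil /= !mul1r.
  apply/forallP/eqP => [H | -> c]; last by rewrite ffunE.
  by apply/ffunP => c; rewrite ffunE; apply/negbTE/H.
case/andP=> c_cs u_cs; rewrite (bigID (fun s => s c)) /=; congr (_ + _).
  rewrite -IH // big_distrr /=.
  (* Switching the marker at [c] matches the states positive at [c] with those that index the sum
     over the tail. *)
  pose on s : kauffman_state m n := [ffun c' => (c' == c) || s c'].
  pose off s : kauffman_state m n := [ffun c' => (c' != c) && s c'].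
  rewrite (reindex_onto on off) => [|s /andP[_ sc]]; last first.
    by apply/ffunP => c'; rewrite !ffunE; case: eqVneq => //= ->.
  apply: eq_big => [s | s /andP[/andP[_ onc] _]].
    apply/idP/idP => [/andP[/andP[/forallP H _] /eqP/ffunP e] | /forallP H].
      apply/forallP => c'; have := H c'; have := e c'; rewrite !ffunE inE.
      by case: (eqVneq c' c) => [->|_] /=; rewrite ?orbT // => <-; rewrite orbT.
    rewrite -andbA; apply/and3P; split.
    - by apply/forallP => c'; rewrite inE ffunE; case: eqP => //= _; apply: H.
    - by rewrite ffunE eqxx.
    apply/eqP/ffunP => c'; rewrite !ffunE; case: (eqVneq c' c) => //= ->.
    by apply/esym/negbTE; have := H c; rewrite (negPf c_cs).
  rewrite state_weight_cons /marker /loop /step onc /= mulr1; congr (_ * _).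
  apply: state_weight_ext => c' c'_cs; rewrite ffunE.
  by case: eqP => // e; rewrite -e c'_cs in c_cs.
rewrite -IH // big_distrr /=; apply: eq_big => [s | s /andP[_ sc]].
  apply/andP/forallP => [[/forallP H sc] c' | H].
    have := H c'; rewrite inE; case: eqP => //= -> _.
    by rewrite sc orbT.
  have sc : ~~ s c by have := H c; rewrite (negPf c_cs).
  by split=> //; apply/forallP => c'; rewrite inE -orbA H orbT.
by rewrite state_weight_cons /marker /loop /step (negPf sc).
Qed.

Lemma uniq_crossings : uniq (@crossings_from m n 0).
Proof.
have <- : [seq (j, i) | j <- enum 'I_m, i <- enum 'I_n] = @crossings_from m n 0.
  by rewrite /crossings_from drop0.
by apply: allpairs_uniq; rewrite ?enum_uniq // => -[? ?] [? ?].
Qed.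

Lemma skein_crossings :
  \sum_(s : kauffman_state m n | yields s C)
    p ^+ #|[set c | s c]| * q ^+ #|[set c | ~~ s c]| * dl ^+ closed_components s
  = skein (crossings_from 0) (lines).
Proof.
rewrite -skein_sum ?uniq_crossings // big_mkcond [RHS]big_mkcond /=.
apply: eq_bigr => s _.
have -> : positive_within (crossings_from 0) s by apply/forallP => c; rewrite mem_crossings.
rewrite /state_weight -yieldsE; case: ifP => _; last by rewrite mulr0.
have [_ _ ->] := trace_state s; rewrite mulr1; congr (_ * _).
have -> : \prod_(c <- @crossings_from m n 0) marker s c = \prod_c marker s c.
  rewrite -[RHS]big_enum; apply: perm_big; apply: uniq_perm => [||c].
  - exact: uniq_crossings.
  - exact: enum_uniq.
  by rewrite mem_crossings mem_enum.
rewrite (bigID (fun c => s c)) /=; congr (_ * _).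
  rewrite -prodr_const; apply: eq_big => [c|c sc]; first by rewrite inE.
  by rewrite inE in sc; rewrite /marker sc.
rewrite -prodr_const; apply: eq_big => [c|c]; first by rewrite inE.
by rewrite inE /marker => /negPf ->.
Qed.

(** An arc with no end on a line still to be smoothed survives to the end, so every remaining state
    disagrees with [C] at [z]. *)
Lemma skein_mismatch cs mu z :
    mu z != C z -> {in cs, forall c, [/\ z != yright c.1, z != xbot c.2,
      mu z != yright c.1 & mu z != xbot c.2]} ->
  skein cs mu = 0.
Proof.
elim: cs mu => [|c cs IH] mu zC sep /=.
  by case: forallP => // /(_ z); rewrite (negPf zC).
have [z1 z2 z3 z4] := sep c (mem_head _ _).
have := smooth_unmoved true z1 z2 z3 z4; have := smooth_unmoved false z1 z2 z3 z4.
rewrite /smooth => eq_m eq_p.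
by rewrite !IH ?eq_p ?eq_m ?mulr0 ?addr0 // => c' c'_cs; apply: sep;
  rewrite inE c'_cs orbT.
Qed.

End Expansion.

(** * Frontiers for three columns *)

Section ThreeColumns.
Variable m : nat.
Notation T := (bpoint m 3).
Implicit Types (mu : T -> T) (j : 'I_m) (k : nat).

Definition column0 : 'I_3 := @Ordinal 3 0 isT.
Definition column1 : 'I_3 := @Ordinal 3 1 isT.
Definition column2 : 'I_3 := @Ordinal 3 2 isT.
Notation B0 := (xbot column0 : T).
Notation B1 := (xbot column1 : T).
Notation B2 := (xbot column2 : T).

Lemma row3 j : row_crossings j = [:: (j, column0); (j, column1); (j, column2)].
Proof.
rewrite /row_crossings; have -> // : enum 'I_3 = [:: column0; column1; column2].
by apply: (inj_map val_inj); rewrite val_enum_ord.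
Qed.

(* What the three vertical lines lead to when followed upwards from below the
   last smoothed row: three boundary points from left to right, or one boundary
   point next to two lines that are joined together. *)
Inductive frontier := Through of T & T & T | CupLeft of T | CupRight of T.

Definition outer (fr : frontier) : seq T :=
  match fr with
  | Through a b c => [:: a; b; c]
  | CupLeft u | CupRight u => [:: u]
  end.

Definition reads mu (fr : frontier) : Prop :=
  match fr with
  | Through a b c => [/\ mu B0 = a, mu B1 = b & mu B2 = c]
  | CupLeft u => mu B0 = B1 /\ mu B2 = u
  | CupRight u => mu B1 = B2 /\ mu B0 = u
  end.

Definition smooth_row (b0 b1 b2 : bool) j mu : T -> T :=
  smooth b2 (yright j) B2 (smooth b1 (yright j) B1 (smooth b0 (yright j) B0 mu)).

Lemma smooth_row_matching b0 b1 b2 j mu :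
  matching mu -> matching (smooth_row b0 b1 b2 j mu).
Proof. by move=> mat; do 3!apply: smooth_matching => //. Qed.

Lemma smooth_row_unmoved b0 b1 b2 j mu z :
    z != yright j -> mu z != yright j ->
    (forall i, z != xbot i) -> (forall i, mu z != xbot i) ->
  smooth_row b0 b1 b2 j mu z = mu z.
Proof.
move=> z1 z2 z3 z4.
have sm b i nu : nu z = mu z -> smooth b (yright j) (xbot i) nu z = mu z.
  by move=> e; rewrite smooth_unmoved ?e.
by do 3!apply: (sm).
Qed.

Variables (C : {ffun T -> T}).
Hypothesis C_matching : matching C.

Definition arc_ends (cl : seq (T * T)) : seq T :=
  flatten [seq [:: e.1; e.2] | e <- cl].

(* After [k] rows the frontier is [fr], and every completed arc is an arc of
   [C], except possibly those listed in [cl]. *)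
Definition at_level k mu fr (cl : seq (T * T)) : Prop :=
  [/\ matching mu, forall j, (k <= j)%N -> mu (yleft j) = yright j,
      reads mu fr /\ {in outer fr, forall z, above k z},
      forall z, above k z -> z \notin outer fr ++ arc_ends cl ->
        mu z = C z /\ above k (mu z)
    & {in cl, forall e, [/\ mu e.1 = e.2, above k e.1 & above k e.2]}].

Lemma aboveS j (z : T) :
  above j.+1 z = [|| z == yleft j, z == yright j | above j z].
Proof.
have vE (i : 'I_m) : (i == j :> nat) = (i == j) by [].
by case: z => [] [] // i /=; rewrite ltnS leq_eqVlt vE.
Qed.

(** The row affects only the old frontier points and the two ends of line [j]; these are shared out
    between the new frontier and the arcs completed in the row. *)
Lemma at_level_row b0 b1 b2 (j : 'I_m) mu fr fr' cl :
    at_level j mu fr [::] -> reads (smooth_row b0 b1 b2 j mu) fr' ->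
    {in cl, forall e, smooth_row b0 b1 b2 j mu e.1 = e.2} ->
    outer fr' ++ arc_ends cl =i yleft j :: yright j :: outer fr ->
  at_level j.+1 (smooth_row b0 b1 b2 j mu) fr' cl.
Proof.
case=> mat lin [rd up] done_ _ rd' rd_cl same.
have [inv ff] := mat.
have upS z : z \in outer fr' ++ arc_ends cl -> above j.+1 z.
  rewrite same !inE aboveS => /or3P[-> //|->|/up ->]; rewrite ?orbT //.
have stay z : above j z -> z \notin outer fr -> 
    smooth_row b0 b1 b2 j mu z = mu z.
  move=> az zo; have [|mz amz] := done_ z az.
    by rewrite /arc_ends /= cats0.
  have zN (w : T) : above j w -> w != yright j /\ forall i, w != xbot i.
    by case: w => [] [] // i lt; split=> // ; apply: contraTneq lt => -[->];
      rewrite /= ltnn.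
  have [? ?] := zN z az; have [? ?] := zN (mu z) amz.
  exact: smooth_row_unmoved.
split.
- exact: smooth_row_matching.
- move=> j' lt; rewrite smooth_row_unmoved ?lin //; try exact: ltnW.
  by apply: contraTneq lt => -[->]; rewrite ltnn.
- by split=> // z zo; apply: upS; rewrite mem_cat zo.
- move=> z; rewrite aboveS same !inE !negb_or => az /and3P[zy zy' zo].
  move: az; rewrite (negPf zy) (negPf zy') /= => az.
  have [|mz amz] := done_ z az; first by rewrite /arc_ends /= cats0.
  by rewrite stay // aboveS amz !orbT.
move=> e e_cl; have sub w : w \in [:: e.1; e.2] -> w \in outer fr' ++ arc_ends cl.
  move=> we; rewrite mem_cat; apply/orP; right; apply/flatten_mapP.
  by exists e.
by rewrite rd_cl // !upS // sub // !inE eqxx ?orbT.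
Qed.

Section Value.
Variables (R : comNzSemiRingType) (p q dl : R).

Lemma skein_closures k mu fr cl v : at_level k mu fr cl ->
    (at_level k mu fr [::] -> skein p q dl C (crossings_from k) mu = v) ->
  skein p q dl C (crossings_from k) mu = (all (fun e => C e.1 == e.2) cl)%:R * v.
Proof.
case=> mat lin rd done_ cls Hv; have [inv _] := mat; have [Cinv _] := C_matching.
case: allP => [ok | bad].
  rewrite mul1r; apply: Hv; split=> // z az; rewrite /arc_ends cats0 => zo.
  have [zc|zc] := boolP (z \in arc_ends cl); last first.
    by apply: done_; rewrite // mem_cat negb_or zo.
  case/flatten_mapP: zc => e e_cl.
  have [mue a1 a2] := cls e e_cl; have /eqP Ce := ok e e_cl.
  rewrite !inE => /orP[] /eqP ->; first by rewrite mue Ce.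
  by rewrite -{1}mue -{1}Ce inv Cinv -mue inv.
have /allPn[e e_cl Ce] : ~~ all (fun e => C e.1 == e.2) cl by apply/allP.
have [mue a1 a2] := cls e e_cl; rewrite mul0r.
apply: (@skein_mismatch _ _ _ _ _ _ _ _ _ e.1) => [|c /le_crossings_from kc].
  by rewrite mue eq_sym.
have aN (w : T) : above k w -> w != yright c.1 /\ w != xbot c.2.
  by case: w => [] [] // i lt; split=> //; apply: contraTneq lt => -[->];
    rewrite /= -leqNgt.
by rewrite mue; have [-> ->] := aN _ a1; have [-> ->] := aN _ a2.
Qed.

(** The expansion seen through frontiers alone. A [Through] frontier has one summand per choice of
    three markers; for a cup, choices leading to the same frontier are collected, and [dl] marks
    those that close the cup into a loop. The tests on [C] reject wrong completed arcs. *)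
Fixpoint value (js : seq 'I_m) (fr : frontier) : R :=
  match js, fr with
  | [::], Through a b c => [&& C B0 == a, C B1 == b & C B2 == c]%:R
  | [::], CupLeft u => ((C B0 == B1) && (C B2 == u))%:R
  | [::], CupRight u => ((C B1 == B2) && (C B0 == u))%:R
  | j :: js', Through a b c =>
    let y := yleft j in let y' := yright j in
    p ^+ 3 * ((C c == y')%:R * value js' (Through y a b))
    + q ^+ 3 * ((C a == y)%:R * value js' (Through b c y'))
    + p ^+ 2 * q * ((C b == c)%:R * value js' (Through y a y'))
    + p * q ^+ 2 * ((C a == b)%:R * value js' (Through y c y'))
    + p ^+ 2 * q * (((C a == y) && (C c == y'))%:R * value js' (CupLeft b))
    + p * q ^+ 2 * (((C a == y) && (C c == y'))%:R * value js' (CupRight b))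
    + p ^+ 2 * q * (((C a == b) && (C c == y'))%:R * value js' (CupRight y))
    + p * q ^+ 2 * (((C a == y) && (C b == c))%:R * value js' (CupLeft y'))
  | j :: js', CupLeft u =>
    let y := yleft j in let y' := yright j in
    (q ^+ 3 + p ^+ 2 * q + p * q ^+ 2 * dl) * value js' (Through y u y')
    + (p ^+ 3 + p * q ^+ 2 + p ^+ 2 * q * dl)
        * ((C u == y')%:R * value js' (CupRight y))
    + p ^+ 2 * q * ((C u == y')%:R * value js' (CupLeft y))
    + p * q ^+ 2 * ((C u == y)%:R * value js' (CupLeft y'))
  | j :: js', CupRight u =>
    let y := yleft j in let y' := yright j in
    (p ^+ 3 + p * q ^+ 2 + p ^+ 2 * q * dl) * value js' (Through y u y')
    + (q ^+ 3 + p ^+ 2 * q + p * q ^+ 2 * dl)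
        * ((C u == y)%:R * value js' (CupLeft y'))
    + p * q ^+ 2 * ((C u == y)%:R * value js' (CupRight y'))
    + p ^+ 2 * q * ((C u == y')%:R * value js' (CupRight y))
  end.

(** Everything but the bottom side is above level [m], so agreement with [C] has only to be tested
    on the frontier. *)
Lemma value_end mu fr : at_level m mu fr [::] ->
  [forall z, mu z == C z]%:R = value [::] fr.
Proof.
case=> [[inv _]] _ [rd _] done_ _; have [Cinv _] := C_matching.
have cols i : i \in [:: column0; column1; column2].
  by case: i => [[|[|[|]]]] // ?; rewrite !inE -!val_eqE.
have ext : {in outer fr, forall z, mu z = C z} -> 
    (forall i, mu (xbot i) = C (xbot i)) -> forall z, mu z == C z.
  move=> eo eb z; apply/eqP.
  have [az|] := boolP (above m z); last first.
    by case: z => [] [] i //=; rewrite ?ltn_ord // => _; apply: eb.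
  have [/eo //|zo] := boolP (z \in outer fr).
  by case: (done_ z az); rewrite /arc_ends ?cats0.
have inv2 z w : mu z = w -> mu w = z by move=> <-.
have Cinv2 z w : C z = w -> C w = z by move=> <-.
suff -> : [forall z, mu z == C z] = match fr with
  | Through a b c => [&& C B0 == a, C B1 == b & C B2 == c]
  | CupLeft u => (C B0 == B1) && (C B2 == u)
  | CupRight u => (C B1 == B2) && (C B0 == u) end
  by case: fr {rd done_ ext}.
apply/forallP/idP => [H|].
  have {}H z : C z = mu z by apply/esym/eqP.
  by case: fr rd {done_ ext} => [a b c [e0 e1 e2]|u [e0 e1]|u [e0 e1]];
    rewrite !H ?e0 ?e1 ?e2 !eqxx.
case: fr rd ext {done_} => [a b c [e0 e1 e2]|u [e0 e2]|u [e1 e0]] ext.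
- case/and3P=> /eqP c0 /eqP c1 /eqP c2; apply: ext => [z|i].
    by rewrite !inE => /or3P[] /eqP ->; rewrite -?e0 -?e1 -?e2 inv ?e0 ?e1 ?e2
      -?c0 -?c1 -?c2 Cinv.
  by have := cols i; rewrite !inE => /or3P[] /eqP ->; congruence.
- case/andP=> /eqP c0 /eqP c2; apply: ext => [z|i].
    by rewrite inE => /eqP ->; rewrite (inv2 _ _ e2) (Cinv2 _ _ c2).
  have := cols i; rewrite !inE => /or3P[] /eqP ->; rewrite ?e0 ?e2 ?c0 ?c2 //.
  by rewrite (inv2 _ _ e0) (Cinv2 _ _ c0).
case/andP=> /eqP c0 /eqP c2; apply: ext => [z|i].
  by rewrite inE => /eqP ->; rewrite (inv2 _ _ e0) (Cinv2 _ _ c2).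
have := cols i; rewrite !inE => /or3P[] /eqP ->; rewrite ?e0 ?e1 ?c0 ?c2 //.
by rewrite (inv2 _ _ e1) (Cinv2 _ _ c0).
Qed.

(** Outcomes enter through [S] and loop exponents through [l0], [l1], [l2], so that the eight
    products are expanded once for all kinds of frontier. *)
Lemma skein_row (j : 'I_m) cs mu (S : bool -> bool -> bool -> R) :
    (forall b0 b1 b2,
       skein p q dl C cs (smooth_row b0 b1 b2 j mu) = S b0 b1 b2) ->
  let mu1 b0 := smooth b0 (yright j) B0 mu in
  let mu2 b0 b1 := smooth b1 (yright j) B1 (mu1 b0) in
  forall (l0 : nat) (l1 : bool -> nat) (l2 : bool -> bool -> nat),
    (mu (yright j) == B0) = l0 :> nat ->
    (forall b0, (mu1 b0 (yright j) == B1) = l1 b0 :> nat) ->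
    (forall b0 b1, (mu2 b0 b1 (yright j) == B2) = l2 b0 b1 :> nat) ->
  skein p q dl C (row_crossings j ++ cs) mu =
    p ^+ 3 * dl ^+ 0 * S true true true
    + q ^+ 3 * dl ^+ (l0 + l1 false + l2 false false) * S false false false
    + p ^+ 2 * q * dl ^+ l2 true true * S true true false
    + p * q ^+ 2 * dl ^+ (l1 true + l2 true false) * S true false false
    + p ^+ 2 * q * dl ^+ l0 * S false true true
    + p * q ^+ 2 * dl ^+ (l0 + l1 false) * S false false true
    + p ^+ 2 * q * dl ^+ l1 true * S true false true
    + p * q ^+ 2 * dl ^+ (l0 + l2 false true) * S false true false.
Proof.
move=> eqS mu1 mu2 l0 l1 l2 e0 e1 e2.
have skein_cons i cs' nu : skein p q dl C ((j, i) :: cs') nu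
    = p * skein p q dl C cs' (smooth true (yright j) (xbot i) nu)
      + q * dl ^+ (nu (yright j) == xbot i)
        * skein p q dl C cs' (smooth false (yright j) (xbot i) nu) by [].
have -> : skein p q dl C (row_crossings j ++ cs) mu =
    p * (p * (p * S true true true
              + q * dl ^+ l2 true true * S true true false)
         + q * dl ^+ l1 true * (p * S true false true
              + q * dl ^+ l2 true false * S true false false))
    + q * dl ^+ l0 * (p * (p * S false true true
              + q * dl ^+ l2 false true * S false true false)
         + q * dl ^+ l1 false * (p * S false false true
              + q * dl ^+ l2 false false * S false false false)).
  by rewrite row3 !cat_cons cat0s !skein_cons -!eqS -e0 -!e1 -!e2.
by rewrite !exprD; ring.
Qed.

Lemma row_leaf (j : 'I_m) js mu fr b0 b1 b2 fr' cl :
    at_level j mu fr [::] ->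
    (forall nu fr0, at_level j.+1 nu fr0 [::] ->
       skein p q dl C (crossings_from j.+1) nu = value js fr0) ->
    reads (smooth_row b0 b1 b2 j mu) fr' /\
      all (fun e => smooth_row b0 b1 b2 j mu e.1 == e.2) cl ->
    outer fr' ++ arc_ends cl =i yleft j :: yright j :: outer fr ->
  skein p q dl C (crossings_from j.+1) (smooth_row b0 b1 b2 j mu)
  = (all (fun e => C e.1 == e.2) cl)%:R * value js fr'.
Proof.
move=> lev IH [rd rd_cl] same; apply: (@skein_closures _ _ fr'); last exact: IH.
by apply: (at_level_row lev) => // e /(allP rd_cl)/eqP.
Qed.

Ltac partner E nu z H :=
  eassert (H : nu z = _) by
    (rewrite /nu /smooth /plus_step /minus_step /transp;
     repeat (rewrite !E /=); reflexivity).

(* Tabulates one smoothed crossing at the points that matter, before it is made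
   opaque: unfolding several of them at once would blow up. *)
Ltac tabulate K E nu j a b c E' :=
  let h0 := fresh "h" in let h1 := fresh "h" in let h2 := fresh "h" in
  let h3 := fresh "h" in let h4 := fresh "h" in let h5 := fresh "h" in
  let h6 := fresh "h" in let h7 := fresh "h" in
  partner E nu (B0 : T) h0; partner E nu (B1 : T) h1; partner E nu (B2 : T) h2;
  partner E nu (yleft j : T) h3; partner E nu (yright j : T) h4;
  partner E nu a h5; partner E nu b h6; partner E nu c h7;
  clearbody nu; pose E' := (K, h0, h1, h2, h3, h4, h5, h6, h7).

Ltac eval_leaf leaf K E mu j a b c :=
  cbv beta iota;
  apply: leaf;
  [ cbv beta iota delta [reads smooth_row all fst snd];
    let nu1 := fresh "nu1" in let nu2 := fresh "nu2" in
    let nu3 := fresh "nu3" in let E1 := fresh "E1" in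
    let E2 := fresh "E2" in let E3 := fresh "E3" in
    set nu1 := smooth _ _ _ mu; tabulate K E nu1 j a b c E1;
    set nu2 := smooth _ _ _ nu1; tabulate K E1 nu2 j a b c E2;
    set nu3 := smooth _ _ _ nu2; tabulate K E2 nu3 j a b c E3;
    rewrite !E3; do ?split
  | let z := fresh "z" in
    move=> z; rewrite /= !inE /=;
    case: (z == yleft j); case: (z == yright j);
    case: (z == a); case: (z == b); case: (z == c); done].

Ltac eval_loops K E mu j a b c :=
  let nu1 := fresh "nu1" in let nu2 := fresh "nu2" in
  let nu3 := fresh "nu3" in let E1 := fresh "E1" in
  let E2 := fresh "E2" in
  set nu1 := smooth _ _ _ mu; tabulate K E nu1 j a b c E1;
  rewrite ?E1 //;
  set nu2 := smooth _ _ _ nu1; tabulate K E1 nu2 j a b c E2;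
  rewrite ?E2 //.

Ltac abstract_ring js :=
  repeat (let v := fresh "v" in set v := value js _; clearbody v);
  repeat (let b := fresh "b" in set b := nat_of_bool _; clearbody b);
  ring.

(** Induction on the number of remaining rows: each of the eight smoothings of a row is evaluated at
    the relevant points, which yields the new frontier and the arcs to compare with [C]. *)
Lemma skein_value k mu fr : (k <= m)%N -> at_level k mu fr [::] ->
  skein p q dl C (crossings_from k) mu = value (drop k (enum 'I_m)) fr.
Proof.
move/subnKC; move: (m - k)%N => d; elim: d => [|d IH] in k mu fr *.
  rewrite addn0 => -> lev.
  by rewrite crossings_from_end drop_oversize ?size_enum_ord // -(value_end lev).
rewrite addnS => e; have lt_km : (k < m)%N by rewrite -e ltnS leq_addr.
set j := Ordinal lt_km; rewrite (enum_ord_drop lt_km) (crossings_fromS _ lt_km).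
rewrite -/j => lev.
have {}IH nu fr0 := IH k.+1 nu fr0 e; rewrite -[k]/(j : nat) in lev IH *.
set js := drop _ _ in IH *.
have {d e IH} leaf b0 b1 b2 fr' cl := @row_leaf j js mu fr b0 b1 b2 fr' cl lev IH.
have [mat lin [rd up] _ _] := lev; have [inv _] := mat.
have upN (w : T) : above j w -> [/\ (w == yright j) = false,
   (w == B0) = false, (w == B1) = false & (w == B2) = false].
  by case: w => [] [] // i lt; split=> //; apply: contraTF lt => /eqP[->];
    rewrite /= ltnn.
have inv2 z w : mu z = w -> mu w = z by move=> <-.
have g0 : mu (yleft j) = yright j by apply: lin.
have g1 := inv2 _ _ g0.

pose cl l : R := (all (fun e => C e.1 == e.2) l)%:R.
case: fr rd up leaf lev => [a b c [e0 e1 e2]|u [e0 e2]|u [e1 e0]] up leaf _.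
- have [a0 a1 a2 a3] := upN a (up _ (mem_head _ _)).
  have [b0 b1 b2 b3] : [/\ (b == (yright j)) = false, (b == B0) = false,
      (b == B1) = false & (b == B2) = false].
    by apply/upN/up; rewrite !inE eqxx ?orbT.
  have [c0 c1 c2 c3] : [/\ (c == (yright j)) = false, (c == B0) = false,
      (c == B1) = false & (c == B2) = false].
    by apply/upN/up; rewrite !inE eqxx ?orbT.
  have f0 := inv2 _ _ e0; have f1 := inv2 _ _ e1; have f2 := inv2 _ _ e2.
  pose K := (eqxx, a0, a1, a2, a3, b0, b1, b2, b3, c0, c1, c2, c3).
  pose E := (K, e0, e1, e2, f0, f1, f2, g0, g1).
  (* From three separate strands no loop can close within one row, whence the zero exponents. *)
  rewrite (@skein_row _ _ _ (fun b0 b1 b2 => match b0, b1, b2 with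
    | true, true, true => cl [:: (c, yright j)] * value js (Through (yleft j) a b)
    | false, false, false => cl [:: (a, yleft j)] * value js (Through b c (yright j))
    | true, true, false => cl [:: (b, c)] * value js (Through (yleft j) a (yright j))
    | true, false, false => cl [:: (a, b)] * value js (Through (yleft j) c (yright j))
    | false, true, true => cl [:: (a, yleft j); (c, yright j)] * value js (CupLeft b)
    | false, false, true => cl [:: (a, yleft j); (c, yright j)] * value js (CupRight b)
    | true, false, true => cl [:: (a, b); (c, yright j)] * value js (CupRight (yleft j))
    | false, true, false => cl [:: (a, yleft j); (b, c)] * value js (CupLeft (yright j))
    end) _ 0%N (fun=> 0%N) (fun _ _ => 0%N)).
  + rewrite /cl /= ?andbT; abstract_ring js.
  + by rewrite /cl; case=> [] [] []; eval_leaf leaf K E mu j a b c.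
  + by rewrite !E.
  + by case; eval_loops K E mu j a b c.
  by case=> [] []; eval_loops K E mu j a b c.
- have [a0 a1 a2 a3] := upN u (up _ (mem_head _ _)).
  have f0 := inv2 _ _ e0; have f2 := inv2 _ _ e2.
  pose K := (eqxx, a0, a1, a2, a3).
  pose E := (K, e0, e2, f0, f2, g0, g1).
  (* A marker +1 at the first crossing moves one end of the left cup to the horizontal line; a
     marker -1 at the second then closes a loop. *)
  rewrite (@skein_row _ _ _ (fun b0 b1 b2 => match b0, b1, b2 with
    | true, true, true => cl [:: (u, yright j)] * value js (CupRight (yleft j))
    | false, true, true => cl [:: (u, yright j)] * value js (CupLeft (yleft j))
    | false, false, true => cl [:: (u, yright j)] * value js (CupRight (yleft j))
    | true, false, true => cl [:: (u, yright j)] * value js (CupRight (yleft j))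
    | false, true, false => cl [:: (u, yleft j)] * value js (CupLeft (yright j))
    | _, _, _ => cl [::] * value js (Through (yleft j) u (yright j))
    end) _ 0%N (fun b => b : nat) (fun _ _ => 0%N)).
  + rewrite /cl /= ?andbT; abstract_ring js.
  + by rewrite /cl; case=> [] [] []; eval_leaf leaf K E mu j u u u.
  + by rewrite !E.
  + by case; eval_loops K E mu j u u u.
  by case=> [] []; eval_loops K E mu j u u u.
have [a0 a1 a2 a3] := upN u (up _ (mem_head _ _)).
have f0 := inv2 _ _ e0; have f1 := inv2 _ _ e1.
pose K := (eqxx, a0, a1, a2, a3).
pose E := (K, e0, e1, f0, f1, g0, g1).
(* For the right cup the same happens at the second and third crossings. *)
rewrite (@skein_row _ _ _ (fun b0 b1 b2 => match b0, b1, b2 with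
  | false, false, false => cl [:: (u, yleft j)] * value js (CupLeft (yright j))
  | false, true, true => cl [:: (u, yleft j)] * value js (CupLeft (yright j))
  | false, true, false => cl [:: (u, yleft j)] * value js (CupLeft (yright j))
  | false, false, true => cl [:: (u, yleft j)] * value js (CupRight (yright j))
  | true, false, true => cl [:: (u, yright j)] * value js (CupRight (yleft j))
  | _, _, _ => cl [::] * value js (Through (yleft j) u (yright j))
  end) _ 0%N (fun=> 0%N) (fun _ b => b : nat)).
+ rewrite /cl /= ?andbT; abstract_ring js.
+ by rewrite /cl; case=> [] [] []; eval_leaf leaf K E mu j u u u.
+ by rewrite !E.
+ by case; eval_loops K E mu j u u u.
by case=> [] []; eval_loops K E mu j u u u.
Qed.
End Value.
End ThreeColumns.

(** * Recurrences between levels *)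

Section CutValues.
Variables (m : nat) (C : {ffun bpoint m 3 -> bpoint m 3}).
Hypothesis C_matching : matching C.
Variables (R : comNzSemiRingType) (p q dl : R).
Notation T := (bpoint m 3).
Notation B0 := (xbot column0 : T).
Notation B1 := (xbot column1 : T).
Notation B2 := (xbot column2 : T).
Notation val k := (value C p q dl (drop k (enum 'I_m))).

(* The values of the frontiers that are compatible with [C] when [u] is the only
   point above level [k] joined by [C] to a point below it: in the last two
   clauses the arc of [C] from [a] to [b] has not been closed yet. *)
Definition cut_values k u (al be si ta : R) : Prop :=
  [/\ val k (CupLeft u) = al, val k (CupRight u) = be,
      forall a b, above k a -> above k b -> C a = b -> val k (Through a b u) = si
    & forall a b, above k a -> above k b -> C a = b -> val k (Through u a b) = ta].

Lemma drop_enum (j : 'I_m) : drop j (enum 'I_m) = j :: drop j.+1 (enum 'I_m).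
Proof.
rewrite (enum_ord_drop (ltn_ord j)); congr (_ :: _).
exact: val_inj.
Qed.

Lemma above_yleft (j : 'I_m) : above j (yleft j : T) = false.
Proof. exact: ltnn. Qed.

Lemma above_yright (j : 'I_m) : above j (yright j : T) = false.
Proof. exact: ltnn. Qed.

Lemma above_neq k (a b : T) : above k a -> above k b = false -> (a == b) = false.
Proof. by move=> ha hb; apply: contraTF ha => /eqP ->; rewrite hb. Qed.

Lemma above_succ (j : 'I_m) (a : T) : above j a -> above j.+1 a.
Proof. by rewrite aboveS => ->; rewrite !orbT. Qed.

Lemma above_yleftS (j : 'I_m) : above j.+1 (yleft j : T).
Proof. by rewrite aboveS eqxx. Qed.

Lemma above_yrightS (j : 'I_m) : above j.+1 (yright j : T).
Proof. by rewrite aboveS eqxx orbT. Qed.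

Lemma C_sym (a b : T) : C a = b -> C b = a.
Proof. by case: C_matching => inv _ <-. Qed.

Lemma yleft_yright (j : 'I_m) : (yleft j == yright j :> T) = false.
Proof. by []. Qed.

Lemma yright_yleft (j : 'I_m) : (yright j == yleft j :> T) = false.
Proof. by []. Qed.

(** Either the row closes the arc from [u] to [yright j], or the next frontier is
    [Through (yleft j) u (yright j)], where that arc is still open. General weights are kept because
    the recurrence serves both the coefficient and the count of states. *)
Lemma cut_values_left (j : 'I_m) u al be si ta :
    above j u -> C u = yright j -> cut_values j.+1 (yleft j) al be si ta ->
  cut_values j u
    (p ^+ 2 * q * al + (p ^+ 3 + p * q ^+ 2 + p ^+ 2 * q * dl) * be
      + (q ^+ 3 + p ^+ 2 * q + p * q ^+ 2 * dl) * ta)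
    (p ^+ 2 * q * be + (p ^+ 3 + p * q ^+ 2 + p ^+ 2 * q * dl) * ta)
    ((p ^+ 3 + p * q ^+ 2) * ta + p ^+ 2 * q * be) (p ^+ 2 * q * ta).
Proof.
move=> hu Cu [Hal Hbe Hsi Hta].
have eta_u : val j.+1 (Through (yleft j) u (yright j)) = ta.
  by apply: Hta; rewrite ?above_yrightS // above_succ.
split; rewrite drop_enum /=; rewrite ?Cu ?eqxx ?yright_yleft ?eta_u ?Hal ?Hbe.
- by rewrite ?mulr0n ?mulr1n; ring.
- by rewrite ?mulr0n ?mulr1n; ring.
- move=> a b ha hb Cab; have Cba := C_sym Cab.
  have na : (a == u) = false.
    by apply/eqP => e; move: hb; rewrite -Cab e Cu above_yright.
  rewrite Cab Cba na eqxx (above_neq hb (above_yleft j)) /=.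
  by rewrite Hta ?above_succ // ?mulr0n ?mulr1n; ring.
move=> a b ha hb Cab; have Cba := C_sym Cab.
have nu : (yright j == a) = false by rewrite eq_sym (above_neq ha (above_yright j)).
rewrite Cab Cba nu eqxx (above_neq ha (above_yright j)) /=.
by rewrite ?mulr0n ?mulr1n; ring.
Qed.

Lemma cut_values_right (j : 'I_m) u al be si ta :
    above j u -> C u = yleft j -> cut_values j.+1 (yright j) al be si ta ->
  cut_values j u
    (p * q ^+ 2 * al + (q ^+ 3 + p ^+ 2 * q + p * q ^+ 2 * dl) * si)
    (p * q ^+ 2 * be + (q ^+ 3 + p ^+ 2 * q + p * q ^+ 2 * dl) * al
      + (p ^+ 3 + p * q ^+ 2 + p ^+ 2 * q * dl) * si)
    (p * q ^+ 2 * si) ((q ^+ 3 + p ^+ 2 * q) * si + p * q ^+ 2 * al).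
Proof.
move=> hu Cu [Hal Hbe Hsi Hta]; have Cy := C_sym Cu.
have eta_u : val j.+1 (Through (yleft j) u (yright j)) = si.
  by apply: Hsi; rewrite ?above_yleftS // above_succ.
split; rewrite drop_enum /=; rewrite ?Cu ?eqxx ?yleft_yright ?eta_u ?Hal ?Hbe.
- by rewrite ?mulr0n ?mulr1n; ring.
- by rewrite ?mulr0n ?mulr1n; ring.
- move=> a b ha hb Cab; have Cba := C_sym Cab.
  have na : (a == u) = false.
    by apply/eqP => e; move: hb; rewrite -Cab e Cu above_yleft.
  rewrite Cab Cba na eqxx (above_neq hb (above_yleft j)) /=.
  by rewrite ?mulr0n ?mulr1n; ring.
move=> a b ha hb Cab; have Cba := C_sym Cab.
have nu : (yleft j == a) = false by rewrite eq_sym (above_neq ha (above_yleft j)).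
rewrite Cab Cba nu eqxx (above_neq ha (above_yright j)) /=.
by rewrite Hsi ?above_succ // ?mulr0n ?mulr1n; ring.
Qed.

(** As [u] is joined to neither end of line [j], its arc stays open, and a single next frontier
    passes the tests. *)
Lemma cut_values_spread (j : 'I_m) u :
    above j u -> above j.+1 (C u) = false ->
    let w := val j.+1 (Through (yleft j) u (yright j)) in
  cut_values j u ((q ^+ 3 + p ^+ 2 * q + p * q ^+ 2 * dl) * w)
    ((p ^+ 3 + p * q ^+ 2 + p ^+ 2 * q * dl) * w)
    (p * q ^+ 2 * w) (p ^+ 2 * q * w).
Proof.
move=> hu Cu w.
have ny : (C u == yleft j) = false.
  by rewrite eq_sym (above_neq (above_yleftS j)).
have ny' : (C u == yright j) = false.
  by rewrite eq_sym (above_neq (above_yrightS j)).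
have na a b : above j b -> C a = b -> (a == u) = false.
  by move=> hb Cab; apply/eqP => e; move: Cu; rewrite -e Cab above_succ.
split; rewrite drop_enum /= ?ny ?ny' -/w.
- by rewrite ?mulr0n; ring.
- by rewrite ?mulr0n; ring.
- move=> a b ha hb Cab; have Cba := C_sym Cab.
  rewrite Cab Cba (na _ _ hb Cab) eqxx (above_neq hb (above_yleft j)) /=.
  by rewrite ?andbF ?mulr0n ?mulr1n; ring.
move=> a b ha hb Cab; have Cba := C_sym Cab.
have nu : (C u == a) = false.
  by apply: contraFF Cu => /eqP ->; rewrite above_succ.
rewrite Cab Cba nu eqxx (above_neq ha (above_yright j)) /= ?ny.
by rewrite ?mulr0n ?mulr1n; ring.
Qed.

Lemma cut_values_end_left u :
  C B0 = B1 -> C B2 = u -> cut_values m u 1 0 0 0.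
Proof.
move=> e0 e2; have f0 := C_sym e0; have f2 := C_sym e2.
have nB i z : above m z -> (xbot i == z :> T) = false.
  by move=> hz; rewrite eq_sym (above_neq hz).
split; rewrite drop_oversize ?size_enum_ord //= ?e0 ?e2 ?f0 ?eqxx ?mulr1n //.
- by move=> a b ha hb _; rewrite ?(nB _ _ ha) ?(nB _ _ hb) ?andbF.
- by move=> a b ha hb _; rewrite ?(nB _ _ ha) ?(nB _ _ hb) ?andbF.
Qed.

Lemma cut_values_end_right u :
  C B1 = B2 -> C B0 = u -> cut_values m u 0 1 0 0.
Proof.
move=> e1 e0; have f1 := C_sym e1.
have nB i z : above m z -> (xbot i == z :> T) = false.
  by move=> hz; rewrite eq_sym (above_neq hz).
split; rewrite drop_oversize ?size_enum_ord //= ?e0 ?e1 ?f1 ?eqxx ?mulr1n //.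
- by case: eqP => // e; have := C_sym e0; rewrite e e1.
- by move=> a b ha hb _; rewrite ?(nB _ _ ha) ?(nB _ _ hb) ?andbF.
- by move=> a b ha hb _; rewrite ?(nB _ _ ha) ?(nB _ _ hb) ?andbF.
Qed.

(** Either one of the arcs to the ends of line [j] stays open, or both close and leave a cup on one
    side of [s2]: four summands. *)
Lemma value_cut (j : 'I_m) s1 s2 s3 al be si ta :
    above j s1 -> above j s2 -> above j s3 ->
    C s1 = yleft j -> C s3 = yright j -> above j.+1 (C s2) = false ->
    cut_values j.+1 s2 al be si ta ->
  val j (Through s1 s2 s3)
  = p ^+ 3 * si + q ^+ 3 * ta + p ^+ 2 * q * al + p * q ^+ 2 * be.
Proof.
move=> h1 h2 h3 C1 C3 C2 [Hal Hbe Hsi Hta]; rewrite drop_enum /=.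
have n23 : (C s2 == s3) = false.
  by apply: contraFF C2 => /eqP ->; rewrite above_succ.
have n12 : (yleft j == s2) = false.
  by rewrite eq_sym (above_neq h2 (above_yleft j)).
rewrite C1 C3 !eqxx n23 n12 Hal Hbe /= ?mulr0n ?mulr1n.
rewrite Hsi ?Hta ?above_yleftS ?above_yrightS ?(above_succ h1) ?(above_succ h3) //.
  by ring.
exact: C_sym.
Qed.

(** Only three markers -1 complete the arc from [s1] to [yleft j] without completing a wrong one. *)
Lemma value_left (j : 'I_m) s1 s2 s3 :
    above j s1 -> above j s2 -> above j s3 ->
    C s1 = yleft j -> above j.+1 (C s2) = false -> above j.+1 (C s3) = false ->
  val j (Through s1 s2 s3) = q ^+ 3 * val j.+1 (Through s2 s3 (yright j)).
Proof.
move=> h1 h2 h3 C1 C2 C3; rewrite drop_enum /=.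
have n23 : (C s2 == s3) = false.
  by apply: contraFF C2 => /eqP ->; rewrite above_succ.
have n12 : (yleft j == s2) = false.
  by rewrite eq_sym (above_neq h2 (above_yleft j)).
have n3 : (C s3 == yright j) = false.
  by rewrite eq_sym (above_neq (above_yrightS j)).
by rewrite C1 !eqxx n23 n12 n3 /= ?mulr0n ?mulr1n; ring.
Qed.

Lemma value_right (j : 'I_m) s1 s2 s3 :
    above j s1 -> above j s2 -> above j s3 ->
    C s3 = yright j -> above j.+1 (C s1) = false -> above j.+1 (C s2) = false ->
  val j (Through s1 s2 s3) = p ^+ 3 * val j.+1 (Through (yleft j) s1 s2).
Proof.
move=> h1 h2 h3 C3 C1 C2; rewrite drop_enum /=.
have n23 : (C s2 == s3) = false.
  by apply: contraFF C2 => /eqP ->; rewrite above_succ.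
have n12 : (C s1 == s2) = false.
  by apply: contraFF C1 => /eqP ->; rewrite above_succ.
have n1 : (C s1 == yleft j) = false.
  by rewrite eq_sym (above_neq (above_yleftS j)).
by rewrite C3 !eqxx n23 n12 n1 /= ?mulr0n ?mulr1n; ring.
Qed.

Lemma value_top s1 s2 s3 :
  C B0 = s1 -> C B1 = s2 -> C B2 = s3 -> val m (Through s1 s2 s3) = 1.
Proof.
by move=> e0 e1 e2; rewrite drop_oversize ?size_enum_ord //= e0 e1 e2 !eqxx.
Qed.

End CutValues.

(** * Planarity and the cuts of a Catalan state *)

Section Planarity.
Variables m n : nat.
Notation T := (bpoint m n).
Variable C : {ffun T -> T}.

Lemma Cat_matching : C \in Cat m n -> matching C.
Proof.
rewrite inE => /andP[/forallP H _]; split=> z; have /andP[? /eqP] := H z; by [].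
Qed.

(* The rank of a boundary point when the boundary is traversed clockwise from
   the bottom left corner: the points above a horizontal line are then
   consecutive. *)
Definition rank (z : T) : nat :=
  match z with
  | inr (inl j) => rev_ord j
  | inl (inl i) => m + i
  | inr (inr j) => m + n + j
  | inl (inr i) => m + n + m + rev_ord i
  end.

Lemma rank_bpos (z : T) :
  (2 * n + m <= bpos z < 2 * n + 2 * m /\ rank z + (2 * n + m) = bpos z
   \/ bpos z < 2 * n + m /\ rank z = bpos z + m)%N.
Proof.
case: z => [[i|i]|[j|j]] /=.
- by right; have := ltn_ord i; lia.
- by right; have := ltn_ord (rev_ord i); rewrite /=; lia.
- by left; have := ltn_ord (rev_ord j); rewrite /=; lia.
by right; have := ltn_ord j; lia.
Qed.

Lemma rank_inj : injective rank.
Proof.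
have rev q (i i' : 'I_q) : rev_ord i = rev_ord i' :> nat -> i = i'.
  by move=> e; apply/rev_ord_inj/val_inj.
case=> [[i|i]|[j|j]] [[i'|i']|[j'|j']] e;
  try (by exfalso; move: e (ltn_ord i) (ltn_ord i'); rewrite /=; lia);
  try (by exfalso; move: e (ltn_ord i) (ltn_ord j'); rewrite /=; lia);
  try (by exfalso; move: e (ltn_ord j) (ltn_ord i'); rewrite /=; lia);
  try (by exfalso; move: e (ltn_ord j) (ltn_ord j'); rewrite /=; lia).
- by congr (inl (inl _)); apply: val_inj; move: e => /=; lia.
- by congr (inl (inr _)); apply: rev; move: e => /=; lia.
- by congr (inr (inl _)); apply: rev.
by congr (inr (inr _)); apply: val_inj; move: e => /=; lia.
Qed.

Lemma above_rank (j : 'I_m) (z : T) :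
  above j z = (rank (yleft j) < rank z < rank (yright j))%N.
Proof.
by case: z => [[i|i]|[i|i]] /=; move: (ltn_ord i) (ltn_ord j); lia.
Qed.

Hypothesis CatC : C \in Cat m n.

(** [rank] is a cyclic shift of [bpos], and interleaving is invariant under such shifts; the four
    rotations of the quadruple cover all positions of the starting corner. *)
Lemma no_crossing (a b : T) :
  (rank a < rank b)%N -> (rank b < rank (C a))%N ->
  (rank (C a) < rank (C b))%N -> False.
Proof.
have [inv _] := Cat_matching CatC.
have N (u v : T) : (bpos u < bpos v)%N -> (bpos v < bpos (C u))%N ->
    (bpos (C u) < bpos (C v))%N -> False.
  move: CatC; rewrite inE => /andP[_ /forallP/(_ u)/forallP/(_ v)].
  by move=> /and3P nc *; apply: nc.
have := N a b; have := N b (C a); have := N (C a) (C b); have := N (C b) a.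
rewrite !inv.
have := rank_bpos a; have := rank_bpos b.
have := rank_bpos (C a); have := rank_bpos (C b).
lia.
Qed.

Lemma nested (a b : T) :
  (rank a < rank b)%N -> (rank b < rank (C a))%N ->
  (rank a < rank (C b) < rank (C a))%N.
Proof.
move=> ab bCa; have [inv ff] := Cat_matching CatC.
apply/andP; split; rewrite ltnNge leq_eqVlt negb_or -leqNgt; apply/andP; split.
- apply: contraTneq bCa => /rank_inj e; rewrite -e inv ltnn //.
- rewrite leqNgt; apply/negP => Cba.
  by apply: (no_crossing Cba); rewrite inv.
- apply: contraTneq ab => /rank_inj/(inv_inj inv) ->; rewrite ltnn //.
rewrite leqNgt; apply/negP; exact: no_crossing.
Qed.

End Planarity.

(** * Cuts of a realizable state *)

Section CutBound.
Variables m n : nat.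
Notation T := (bpoint m n).
Implicit Types (mu : T -> T) (s : kauffman_state m n).

Lemma run_unmoved s (cs : seq (crossing m n)) mu z :
    {in cs, forall c, [/\ z != yright c.1, z != xbot c.2,
      mu z != yright c.1 & mu z != xbot c.2]} ->
  run s cs mu z = mu z.
Proof.
elim: cs mu => //= c cs IH mu sep.
have [z1 z2 z3 z4] := sep c (mem_head _ _).
have e : step s c mu z = mu z by apply: smooth_unmoved.
by rewrite IH e // => c' c'_cs; apply: sep; rewrite inE c'_cs orbT.
Qed.

Lemma run_prefix s k : (k <= m)%N -> exists mu,
  [/\ matching mu, forall j : 'I_m, (k <= j)%N -> mu (yleft j) = yright j
    & run s (crossings_from 0) lines = run s (crossings_from k) mu].
Proof.
elim: k => [_|k IH lt_km]; first by exists lines; split=> //; apply: lines_matching.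
have [mu [mat lin ->]] := IH (ltnW lt_km).
exists (run s (row_crossings (Ordinal lt_km)) mu); split.
- elim: (row_crossings _) mu mat {lin} => //= c cs IHc mu mat.
  exact/IHc/step_matching.
- move=> j lt_kj; rewrite run_unmoved lin ?(ltnW lt_kj) // => c /mapP[i _ ->] /=.
  by split=> //; apply: contraTneq lt_kj => -[->]; rewrite /= ltnn.
by rewrite (crossings_fromS _ lt_km) run_cat.
Qed.

(** Stop a realizing state after [k] rows. A point above whose arc in [C] goes below must then be
    matched to the bottom end of a vertical line, since an arc with both ends above would be final;
    there are [n] such ends. *)
Lemma hcut_le (C : {ffun T -> T}) k :
  realizable C -> (k <= m)%N -> (hcut C k <= n)%N.
Proof.
case/existsP=> s; rewrite yieldsE => /forallP sC le_km.
have [mu [[inv ff] lin run_mu]] := run_prefix s le_km.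
rewrite run_mu in sC.
suff sub z : above k z -> ~~ above k (C z) -> mu z \in [set xbot i | i : 'I_n].
  rewrite /hcut -(card_imset _ (inv_inj inv)) -[leqRHS]card_ord.
  rewrite -(card_imset _ (f := @xbot m n)) => [|i i' [->] //].
  apply/subset_leq_card/subsetP => w /imsetP[z].
  by rewrite inE => /andP[hz hCz] ->; apply: sub.
move=> hz; apply: contraR => nx.
have amz : above k (mu z).
  case e: (mu z) => [[i|i]|[j|j]] //=.
  - by case/negP: nx; rewrite e; apply: imset_f.
  - rewrite ltnNge; apply: contraTN hz => le_kj.
    by rewrite -(inv z) e (lin _ le_kj) /= -leqNgt.
  rewrite ltnNge; apply: contraTN hz => le_kj.
  by rewrite -(inv z) e -[inr (inr j)](lin _ le_kj) inv /= -leqNgt.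
have aN (w : T) c : above k w -> c \in crossings_from k ->
    w != yright c.1 /\ w != xbot c.2.
  move=> aw /le_crossings_from kc.
  by case: w aw => [] [] // i lt; split=> //; apply: contraTneq lt => -[->];
    rewrite /= -leqNgt.
rewrite -(eqP (sC z)) run_unmoved // => c cc.
by have [-> ->] := aN _ _ hz cc; have [-> ->] := aN _ _ amz cc.
Qed.

End CutBound.

(** * Levels with one or three cuts *)

Section Profile.
Variables (m : nat) (C : {ffun bpoint m 3 -> bpoint m 3}).
Hypothesis CatC : C \in Cat m 3.
Notation T := (bpoint m 3).
Notation B0 := (xbot column0 : T).
Notation B1 := (xbot column1 : T).
Notation B2 := (xbot column2 : T).
Notation X0 := (xtop column0 : T).
Notation X1 := (xtop column1 : T).
Notation X2 := (xtop column2 : T).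

Let C_mat : matching C := Cat_matching CatC.

Definition one_cut k u : Prop :=
  above k u /\ forall z, above k z -> above k (C z) = (z != u).

Definition three_cuts k s1 s2 s3 : Prop :=
  [/\ [/\ above k s1, above k s2 & above k s3],
      (rank s1 < rank s2 < rank s3)%N
    & forall z, above k z -> above k (C z) = (z \notin [:: s1; s2; s3])].

Lemma hcut_one k u : one_cut k u -> hcut C k = 1%N.
Proof.
case=> hu cut; rewrite /hcut -[RHS](cards1 u); congr #|pred_of_set _|.
apply/setP => z; rewrite !inE; case: (boolP (above k z)) => [hz|hz] /=.
  by rewrite cut // negbK.
by apply/esym; apply: contraNF hz => /eqP ->.
Qed.

Lemma hcut_three k s1 s2 s3 : three_cuts k s1 s2 s3 -> hcut C k = 3%N.
Proof.
case=> [[h1 h2 h3] /andP[s12 s23] cut]; rewrite /hcut.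
have u : uniq [:: s1; s2; s3].
  rewrite /= !inE negb_or !andbT; apply/andP; split; first (apply/andP; split).
  - by apply: contraTneq s12 => ->; rewrite ltnn.
  - by apply: contraTneq s12 => ->; rewrite -leqNgt ltnW.
  by apply: contraTneq s23 => ->; rewrite ltnn.
rewrite -[RHS](card_uniqP u); apply: eq_card => z; rewrite !inE.
have [hz|hz] := boolP (above k z); first by rewrite cut // negbK !inE.
apply/esym/negbTE; apply: contra hz.
by case/or3P => /eqP ->.
Qed.

Lemma between (j : 'I_m) (z w : T) : above j w ->
    (rank (yleft j : T) < rank z < rank w)%N
    \/ (rank w < rank z < rank (yright j : T))%N ->
  above j z.
Proof.
rewrite !above_rank => /andP[w1 w2] [] /andP[z1 z2]; apply/andP; split=> //;
  [exact: ltn_trans w2 | exact: ltn_trans z1].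
Qed.

Lemma notaboveS (j : 'I_m) (z : T) : above j z = false -> z != yleft j ->
  z != yright j -> above j.+1 z = false.
Proof. by rewrite aboveS => -> /negPf -> /negPf ->. Qed.

(** If [u] is joined to neither end of line [j], these ends are not joined to each other, as their
    arc would cross that of [u], nor to a point above, as [u] has the only cut; so both give new
    cuts. *)
Lemma one_cut_step (j : 'I_m) u : one_cut j u ->
  [\/ C u = yright j /\ one_cut j.+1 (yleft j),
      C u = yleft j /\ one_cut j.+1 (yright j)
    | above j.+1 (C u) = false /\ three_cuts j.+1 (yleft j) u (yright j)].
Proof.
case=> hu cut; have [inv ff] := C_mat.
have CK z w : C z = w -> C w = z by move=> <-.
have aCu : above j (C u) = false by rewrite cut // eqxx.
have back z : above j (C z) -> above j z = false -> z = C u.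
  move=> hCz hz; rewrite -(inv z); congr (C _); apply/eqP.
  by move: hz; rewrite -{1}(inv z) cut // => /negbFE.
have yl := above_yleft j; have yr := above_yright j.
have [Cur|Cur] := eqVneq (C u) (yright j).
  apply: Or31; split=> //; split=> [|z]; first exact: above_yleftS.
  rewrite [above _ z]aboveS => /or3P[/eqP->|/eqP->|hz].
  - rewrite eqxx; apply: notaboveS => //.
      by apply/negP => /back/(_ yl)/eqP; rewrite Cur.
    by apply/eqP => /CK e; move: hu; rewrite -(inv u) Cur e yl.
  - by rewrite (CK _ _ Cur) above_succ.
  rewrite (above_neq hz yl); have [->|zu] := eqVneq z u.
    by rewrite Cur above_yrightS.
  by rewrite above_succ // cut.
have [Cul|Cul] := eqVneq (C u) (yleft j).
  apply: Or32; split=> //; split=> [|z]; first exact: above_yrightS.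
  rewrite [above _ z]aboveS => /or3P[/eqP->|/eqP->|hz].
  - by rewrite (CK _ _ Cul) above_succ.
  - rewrite eqxx; apply: notaboveS => //.
      by apply/negP => /back/(_ yr)/eqP; rewrite Cul.
    by apply/eqP => /CK e; move: hu; rewrite -(inv u) Cul e yr.
  rewrite (above_neq hz yr); have [->|zu] := eqVneq z u.
    by rewrite Cul above_yleftS.
  by rewrite above_succ // cut.
have aCuS := notaboveS aCu Cul Cur.
move: (hu); rewrite above_rank => /andP[u1 u2].
have nlr : C (yleft j) != yright j.
  apply/eqP => e; have := nested CatC (a := yleft j) (b := u).
  by rewrite e => /(_ u1 u2); rewrite -above_rank aCu.
apply: Or33; split=> //; split.
- by rewrite above_yleftS above_yrightS above_succ.
- by rewrite u1.
move=> z; rewrite [above _ z]aboveS !inE => /or3P[/eqP->|/eqP->|hz].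
- rewrite eqxx; apply: notaboveS => //.
  by apply/negP => /back/(_ yl) e; rewrite e eqxx in Cul.
- rewrite eqxx !orbT; apply: notaboveS => //.
    by apply/negP => /back/(_ yr) e; rewrite e eqxx in Cur.
  by apply: contra nlr => /eqP/CK ->.
rewrite (above_neq hz yl) (above_neq hz yr) orbF /=.
have [->|zu] := eqVneq z u => //.
by rewrite above_succ // cut.
Qed.

(** By planarity only [s1] can be joined to the left end of line [j], and only [s3] to the right
    one. If neither is, the next level has too many cuts for a realizable state. *)
Lemma three_cuts_step (j : 'I_m) s1 s2 s3 :
    realizable C -> three_cuts j s1 s2 s3 ->
  [\/ [/\ C s1 = yleft j, C s3 = yright j, above j.+1 (C s2) = false
        & one_cut j.+1 s2],
      [/\ C s1 = yleft j, above j.+1 (C s2) = false, above j.+1 (C s3) = false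
        & three_cuts j.+1 s2 s3 (yright j)]
    | [/\ C s3 = yright j, above j.+1 (C s1) = false, above j.+1 (C s2) = false
        & three_cuts j.+1 (yleft j) s1 s2]].
Proof.
move=> real_C; case=> [[h1 h2 h3] /andP[s12 s23] cut]; have [inv ff] := C_mat.
have CK z w : C z = w -> C w = z by move=> <-.
have cs z : z \in [:: s1; s2; s3] -> above j (C z) = false.
  by move=> hz; rewrite cut ?hz //; move: hz; rewrite !inE => /or3P[]/eqP ->.
have c1 := cs _ (mem_head _ _).
have c2 : above j (C s2) = false by apply: cs; rewrite !inE eqxx orbT.
have c3 : above j (C s3) = false by apply: cs; rewrite !inE eqxx !orbT.
have back z : above j (C z) -> above j z = false -> C z \in [:: s1; s2; s3].
  by move=> hCz; rewrite -{1}(inv z) cut // => /negbFE.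
have yl := above_yleft j; have yr := above_yright j.
(* An arc from [w] to [yleft j] encloses the points above of smaller rank, so no cut starts at such
   a [b]. The case [w = yright j] excludes an arc joining both ends of the line. *)
have lowL (b w : T) : above j b -> above j (C b) = false ->
    C w = yleft j -> (rank b < rank w)%N -> above j w \/ w = yright j -> False.
  move=> hb hCb /CK Cw bw hw.
  move: (hb); rewrite above_rank => /andP[b1 _].
  have := nested CatC (a := yleft j) (b := b); rewrite Cw => /(_ b1 bw) btw.
  case: hw => [hw|ew]; last by rewrite ew -above_rank hCb in btw.
  by have := between hw (or_introl btw); rewrite hCb.
have lowR (b w : T) : above j b -> above j (C b) = false ->
    C w = yright j -> (rank w < rank b)%N -> above j w -> False.
  move=> hb hCb Cw wb hw.
  move: (hb); rewrite above_rank => /andP[_ b2].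
  have := nested CatC (a := w) (b := b); rewrite Cw => /(_ wb b2) btw.
  by have := between hw (or_intror btw); rewrite hCb.
have n2l : C s2 != yleft j.
  by apply/eqP => e; apply: (lowL s1 s2) => //; left.
have n3l : C s3 != yleft j.
  by apply/eqP => e; apply: (lowL s2 s3) => //; left.
have nrl : C (yright j) != yleft j.
  apply/eqP => e; apply: (lowL s1 (yright j)) => //; last by right.
  by move: h1; rewrite above_rank => /andP[].
have n1r : C s1 != yright j by apply/eqP => e; apply: (lowR s2 s1).
have n2r : C s2 != yright j by apply/eqP => e; apply: (lowR s3 s2).
have nlr : C (yleft j) != yright j by apply: contra nrl => /eqP/CK ->.
have cS2 : above j.+1 (C s2) = false by apply: notaboveS.
have low z : above j z -> z \notin [:: s1; s2; s3] -> above j.+1 (C z).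
  by move=> hz zs; rewrite above_succ // cut.
have yrS : C s3 != yright j -> above j.+1 (C (yright j)) = false.
  move=> n3r; apply: notaboveS => //; apply/negP => hCy.
  have := back _ hCy yr; rewrite !inE => /or3P[]/eqP/CK e.
  - by rewrite e eqxx in n1r.
  - by rewrite e eqxx in n2r.
  by rewrite e eqxx in n3r.
have ylS : C s1 != yleft j -> above j.+1 (C (yleft j)) = false.
  move=> n1l; apply: notaboveS => //; apply/negP => hCy.
  have := back _ hCy yl; rewrite !inE => /or3P[]/eqP/CK e.
  - by rewrite e eqxx in n1l.
  - by rewrite e eqxx in n2l.
  by rewrite e eqxx in n3l.
have neq12 : s1 != s2 by apply: contraTneq s12 => ->; rewrite ltnn.
have neq23 : s2 != s3 by apply: contraTneq s23 => ->; rewrite ltnn.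
have neq13 : s1 != s3.
  by apply: contraTneq s12 => ->; rewrite -leqNgt ltnW.
have [C1|C1] := eqVneq (C s1) (yleft j); have [C3|C3] := eqVneq (C s3) (yright j).
- apply: Or31; split=> //; split=> [|z]; first exact: above_succ.
  rewrite [above _ z]aboveS => /or3P[/eqP->|/eqP->|hz].
  + rewrite (CK _ _ C1) above_succ //.
    by rewrite eq_sym (above_neq h2 yl).
  + rewrite (CK _ _ C3) above_succ //.
    by rewrite eq_sym (above_neq h2 yr).
  have [->|zs2] := eqVneq z s2; first by rewrite cS2.
  have [->|zs1] := eqVneq z s1; first by rewrite C1 above_yleftS.
  have [->|zs3] := eqVneq z s3; first by rewrite C3 above_yrightS.
  by rewrite low // !inE negb_or zs1 negb_or zs2 zs3.
- have cS3 : above j.+1 (C s3) = false by apply: notaboveS.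
  apply: Or32; split=> //; split.
  + by split; rewrite ?above_yrightS // above_succ.
  + by rewrite s23; move: h3; rewrite above_rank => /andP[].
  move=> z; rewrite [above _ z]aboveS !inE => /or3P[/eqP->|/eqP->|hz].
  + rewrite (CK _ _ C1) above_succ // ![yleft j == _]eq_sym.
    by rewrite (above_neq h2 yl) (above_neq h3 yl).
  + by rewrite yrS // eqxx !orbT.
  rewrite (above_neq hz yr) orbF.
  have [->|zs2] := eqVneq z s2; first by rewrite cS2.
  have [->|zs3] := eqVneq z s3; first by rewrite cS3.
  have [->|zs1] := eqVneq z s1; first by rewrite C1 above_yleftS.
  by rewrite low // !inE negb_or zs1 negb_or zs2 zs3.
- have cS1 : above j.+1 (C s1) = false by apply: notaboveS.
  apply: Or33; split=> //; split.
  + by split; rewrite ?above_yleftS // above_succ.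
  + by rewrite s12 andbT; move: h1; rewrite above_rank => /andP[].
  move=> z; rewrite [above _ z]aboveS !inE => /or3P[/eqP->|/eqP->|hz].
  + by rewrite ylS // eqxx.
  + rewrite (CK _ _ C3) above_succ // ![yright j == _]eq_sym.
    by rewrite (above_neq h1 yr) (above_neq h2 yr).
  rewrite (above_neq hz yl) /=.
  have [->|zs1] := eqVneq z s1; first by rewrite cS1.
  have [->|zs2] := eqVneq z s2; first by rewrite cS2.
  have [->|zs3] := eqVneq z s3; first by rewrite C3 above_yrightS.
  by rewrite low // !inE negb_or zs1 negb_or zs2 zs3.
have cS1 : above j.+1 (C s1) = false by apply: notaboveS.
have cS3 : above j.+1 (C s3) = false by apply: notaboveS.
have le3 := hcut_le real_C (ltn_ord j).
(* These four points would all be upper ends of cuts at level [j.+1], against the bound 3. *)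
have u4 : uniq [:: yleft j; s1; s2; s3].
  rewrite /= !inE !negb_or neq12 neq13 neq23 ![yleft j == _]eq_sym.
  by rewrite (above_neq h1 yl) (above_neq h2 yl) (above_neq h3 yl).
have sub : {subset [:: yleft j; s1; s2; s3]
             <= [set z | above j.+1 z && ~~ above j.+1 (C z)]}.
  move=> z; rewrite !inE => /or4P[]/eqP ->.
  - by rewrite above_yleftS ylS.
  - by rewrite cS1 above_succ.
  - by rewrite cS2 above_succ.
  by rewrite cS3 above_succ.
have := leq_trans (subset_leq_card (introT subsetP sub)) le3.
by rewrite (card_uniqP u4).
Qed.

(** An arc joining the outer top points would leave no partner for the middle one, so a return on
    the top side joins neighbours. *)
Lemma top_cuts :
  [\/ three_cuts 0 X0 X1 X2, C X0 = X1 /\ one_cut 0 X2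
    | C X1 = X2 /\ one_cut 0 X0].
Proof.
have [inv ff] := C_mat; have CK z w : C z = w -> C w = z by move=> <-.
have top z : above 0 z -> [\/ z = X0, z = X1 | z = X2].
  case: z => [] [] // [[|[|[|]]]] // lt _; [apply: Or31 | apply: Or32 | apply: Or33];
    by congr (inl (inl _)); apply: val_inj.
have n02 : C X0 != X2.
  apply/eqP => e; have := nested CatC (a := X0) (b := X1).
  rewrite e => /(_ _ _)/andP[]; rewrite /= ?ltn_add2l // => r1 r2.
  have : above 0 (C X1).
    case: (C X1) r1 r2 => [] [] //= i; have := ltn_ord i; lia.
  case/top => e1; [move: r1 | move: (ff X1) | move: r2];
    by rewrite e1 ?eqxx ?ltnn //= ltnn.
have [e01|n01] := eqVneq (C X0) X1.
  apply: Or32; split=> //; split=> // z /top[] ->.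
  - by rewrite e01.
  - by rewrite (CK _ _ e01).
  rewrite eqxx; apply/negP => /top[]/CK.
  - by move/eqP; rewrite (negPf n02).
  - by rewrite (CK _ _ e01).
  by move/eqP; rewrite (negPf (ff _)).
have [e12|n12] := eqVneq (C X1) X2.
  apply: Or33; split=> //; split=> // z /top[] ->.
  - rewrite eqxx; apply/negP => /top[]/eqP.
    + by rewrite (negPf (ff _)).
    + by rewrite (negPf n01).
    by rewrite (negPf n02).
  - by rewrite e12.
  by rewrite (CK _ _ e12).
apply: Or31; split=> //; first by rewrite /= !ltn_add2l.
move=> z hz; have -> : (z \in [:: X0; X1; X2]) by case/top: hz => ->.
apply/negP => /top; case/top: hz => ->; case; move/eqP;
  rewrite ?(negPf (ff _)) ?(negPf n01) ?(negPf n02) ?(negPf n12) //.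
- by move/eqP/CK/eqP; rewrite (negPf n01).
- by move/eqP/CK/eqP; rewrite (negPf n02).
by move/eqP/CK/eqP; rewrite (negPf n12).
Qed.

Lemma bottom_xbot (z : T) : above m z = false -> exists i, z = xbot i.
Proof.
by case: z => [] [] //= i; rewrite ?ltn_ord //; exists i.
Qed.

(** The cut cannot reach the middle bottom point: the outer two would be joined and separate it from
    [u]. *)
Lemma one_cut_bottom u : one_cut m u ->
  (C B0 = B1 /\ C B2 = u) \/ (C B1 = B2 /\ C B0 = u).
Proof.
case=> hu cut; have [inv ff] := C_mat.
have CK z w : C z = w -> C w = z by move=> <-.
have [i Cu] : exists i, C u = xbot i by apply: bottom_xbot; rewrite cut ?eqxx.
have low i' : i' != i -> exists i2, C (xbot i') = xbot i2 /\ i2 != i.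
  move=> ne; have [hz|hz] := boolP (above m (C (xbot i'))).
    have := cut _ hz; rewrite inv /= => /esym/negbFE/eqP e.
    by case/eqP: ne; move: Cu; rewrite -e inv => -[].
  have [i2 e] := bottom_xbot (negbTE hz); exists i2; split=> //.
  by apply: contraTneq hu => ei; move/CK: e; rewrite ei -Cu inv => ->.
have n_i i' i2 : C (xbot i') = xbot i2 -> i2 != i'.
  by move=> e; apply: contraNneq (ff (xbot i')) => ei; rewrite e ei eqxx.
have col (i' : 'I_3) : [\/ i' = column0, i' = column1 | i' = column2].
  by case: i' => [[|[|[|]]]] // lt; [apply: Or31 | apply: Or32 | apply: Or33];
    apply: val_inj.
case/col: (i) => ei; rewrite ei in Cu low.
- right; split; last exact: CK.
  have [//|i2 [e n0]] := low column1.
  by case/col: (i2) e (n_i _ _ e) n0 => ->.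
- exfalso; have [//|i2 [e n1]] := low column0.
  have {}e : C B0 = B2 by case/col: (i2) e (n_i _ _ e) n1 => ->.
  have lt : (rank u < m + 3 + m)%N.
    case: (u) hu => [] [] //= i'; have := ltn_ord i'; lia.
  have := nested CatC (a := u) (b := B2); rewrite Cu (CK _ _ e) /=.
  by move=> /(_ _ _)/andP[||_]; rewrite /=; lia.
left; split; last exact: CK.
have [//|i2 [e n0]] := low column0.
by case/col: (i2) e (n_i _ _ e) n0 => ->.
Qed.

Lemma three_cuts_bottom s1 s2 s3 : three_cuts m s1 s2 s3 ->
  [/\ C B0 = s1, C B1 = s2 & C B2 = s3].
Proof.
case=> [[h1 h2 h3] /andP[s12 s23] cut]; have [inv ff] := C_mat.
have CK z w : C z = w -> C w = z by move=> <-.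
have cs z : above m z -> z \in [:: s1; s2; s3] -> exists i, C z = xbot i.
  by move=> hz zs; apply: bottom_xbot; rewrite cut ?zs.
have [i1 e1] := cs s1 h1 (mem_head _ _).
have [i2 e2] : exists i, C s2 = xbot i by apply: cs; rewrite ?inE ?eqxx ?orbT.
have [i3 e3] : exists i, C s3 = xbot i by apply: cs; rewrite ?inE ?eqxx ?orbT.
have lt (u : T) : above m u -> (rank u < m + 3 + m)%N.
  by case: u => [] [] //= i'; have := ltn_ord i'; lia.
have := nested CatC (a := s1) (b := s2); rewrite e1 e2 => /(_ s12 _)/andP[|_].
  by apply: leq_trans (lt _ h2) _; rewrite /= leq_addr.
have := nested CatC (a := s2) (b := s3); rewrite e2 e3 => /(_ s23 _)/andP[|_].
  by apply: leq_trans (lt _ h3) _; rewrite /= leq_addr.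
rewrite /= !ltn_add2l => r32 r21.
have l1 := ltn_ord i1; have l2 := ltn_ord i2; have l3 := ltn_ord i3.
have [v1 v2 v3] : [/\ i1 = 0%N :> nat, i2 = 1%N :> nat & i3 = 2%N :> nat].
  by split; lia.
split; apply: CK; rewrite ?e1 ?e2 ?e3; congr (xbot _); exact: val_inj.
Qed.

End Profile.

(** * The values at all levels *)

Section Invariant.
Variables (m : nat) (C : {ffun bpoint m 3 -> bpoint m 3}).
Hypotheses (CatC : C \in Cat m 3) (real_C : realizable C).
Notation T := (bpoint m 3).
Variables (F : fieldType) (A : F).
Hypothesis A_neq0 : A != 0.
Notation dd := (A ^- 2 + A ^+ 2).
Notation val k := (value C A A^-1 (- A ^+ 2 - A ^- 2) (drop k (enum 'I_m))).
Notation count k := (value C (1 : nat) (1 : nat) (1 : nat) (drop k (enum 'I_m))).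

Let C_mat : matching C := Cat_matching CatC.

(** The last factor is [A^-4 + 1 + A^4], in the form in which the recurrences produce it. *)
Definition product_form (x : F) : Prop := exists (a : int) (b c : nat),
  x = A ^ a * dd ^+ b * (dd ^+ 2 - 1) ^+ c.

Lemma product_form_exp (a : int) : product_form (A ^ a).
Proof. by exists a, 0%N, 0%N; rewrite !expr0 !mulr1. Qed.

Lemma product_form1 : product_form 1.
Proof. exact: (product_form_exp 0). Qed.

Lemma product_form_dd : product_form dd.
Proof. by exists 0, 1%N, 0%N; rewrite expr0z mulr1 mul1r. Qed.

Lemma product_form_dd1 : product_form (dd ^+ 2 - 1).
Proof. by exists 0, 0%N, 1%N; rewrite expr0z !mul1r. Qed.

Lemma product_formM x y : product_form x -> product_form y -> product_form (x * y).
Proof.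
move=> [a [b [c ->]]] [a' [b' [c' ->]]]; exists (a + a'), (b + b')%N, (c + c')%N.
by rewrite expfzDr // !exprD; ring.
Qed.

Lemma product_formX x n : product_form x -> product_form (x ^+ n).
Proof.
move=> fx; elim: n => [|n IH]; first exact: product_form1.
by rewrite exprS; apply: product_formM.
Qed.

Lemma product_formA x : product_form x -> product_form (A * x).
Proof. exact: product_formM (product_form_exp 1). Qed.

Lemma product_formV x : product_form x -> product_form (A^-1 * x).
Proof. exact: product_formM (product_form_exp (-1)). Qed.

Lemma dd_sqrB1 : dd ^+ 2 - 1 = A ^- 4 + 1 + A ^+ 4.
Proof. by field. Qed.

Lemma clear_denominators :
  A ^+ 4 * (A ^- 4 + 1 + A ^+ 4) = A ^+ 8 + A ^+ 4 + 1.
Proof. by field. Qed.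

Definition geom (c : nat) : F := \sum_(i < c) dd ^+ (2 * i).

Lemma geomS c : geom c.+1 = dd ^+ 2 * geom c + 1.
Proof.
rewrite /geom big_ord_recl muln0 expr0 addrC big_distrr /=; congr (_ + _).
by apply: eq_bigr => i _; rewrite -exprD -mulnS.
Qed.

Lemma geomE c : (dd ^+ 2 - 1) * geom c = dd ^+ (2 * c) - 1.
Proof.
elim: c => [|c IH]; first by rewrite /geom big_ord0 muln0 expr0 mulr0 subrr.
by rewrite geomS mulrDr mulrCA IH mulnS exprD; ring.
Qed.

Lemma geom0 : geom 0 = 0. Proof. exact: big_ord0. Qed.

Lemma cut_values_eq (R : comNzSemiRingType) (p q dl : R) k u
    al be si ta al' be' si' ta' :
    cut_values C p q dl k u al be si ta ->
    [/\ al = al', be = be', si = si' & ta = ta'] ->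
  cut_values C p q dl k u al' be' si' ta'.
Proof. by move=> cv [<- <- <- <-]. Qed.

(** At these weights [q^3 + p^2 q + p q^2 dl] and [p^3 + p q^2 + p^2 q dl] vanish: a return slides
    through a horizontal line. What remains of the mixed terms is [p^3 + p q^2 = A dd]. *)
Lemma val_left (j : 'I_m) u al be si ta : above j u -> C u = yright j ->
    cut_values C A A^-1 (- A ^+ 2 - A ^- 2) j.+1 (yleft j) al be si ta ->
  cut_values C A A^-1 (- A ^+ 2 - A ^- 2) j u
    (A * al) (A * be) (A * (dd * ta + be)) (A * ta).
Proof.
move=> hu Cu /(cut_values_left C_mat hu Cu)/cut_values_eq; apply.
by split; field.
Qed.

Lemma val_right (j : 'I_m) u al be si ta : above j u -> C u = yleft j ->
    cut_values C A A^-1 (- A ^+ 2 - A ^- 2) j.+1 (yright j) al be si ta ->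
  cut_values C A A^-1 (- A ^+ 2 - A ^- 2) j u
    (A^-1 * al) (A^-1 * be) (A^-1 * si) (A^-1 * (dd * si + al)).
Proof.
move=> hu Cu /(cut_values_right C_mat hu Cu)/cut_values_eq; apply.
by split; field.
Qed.

Lemma val_spread (j : 'I_m) u w : above j u -> above j.+1 (C u) = false ->
    val j.+1 (Through (yleft j) u (yright j)) = w ->
  cut_values C A A^-1 (- A ^+ 2 - A ^- 2) j u 0 0 (A^-1 * w) (A * w).
Proof.
move=> hu Cu <-.
have cv := cut_values_spread C_mat A A^-1 (- A ^+ 2 - A ^- 2) hu Cu.
apply: (cut_values_eq cv).
by split; field.
Qed.

(* The value of a frontier with three points of which only the middle one is
   still joined below by [C] at the next level. *)
Definition split_value (al be si ta : F) : F :=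
  A ^+ 3 * si + A ^- 3 * ta + A * al + A^-1 * be.

(* The shape of the values while every level from the current one down cuts
   [C] once, when the bottom return of [C] is on the left; primes are numbers
   of Kauffman states. *)
Definition thin_form (z al be si ta : F) (be' si' ta' : nat) : Prop :=
  exists c e : nat,
  [/\ al = z, be = 0, si = z * (dd * geom c), ta = z * geom e
    & (c = 0%N -> si' = 0%N) /\ (e = 0%N -> be' = 0%N /\ ta' = 0%N)].

(** Values of the coefficient expansion, together with the values at weights 1, which count states.
    The clause on [split_value] serves a level with three cuts just above. The alternative records
    that a level with three cuts has been met, and then both cups are worth 0, or that all lower
    levels cut once, up to mirror image. *)
Definition tail_values k u : Prop :=
  exists (al be si ta : F) (al' be' si' ta' : nat),
  [/\ cut_values C A A^-1 (- A ^+ 2 - A ^- 2) k u al be si ta,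
      cut_values C (1 : nat) (1 : nat) (1 : nat) k u al' be' si' ta',
      product_form (split_value al be si ta)
    & (exists i : nat, [/\ (i <= m)%N, hcut C i = 3%N, al = 0 /\ be = 0,
                           product_form si & product_form ta])
      \/ (forall i, (k <= i <= m)%N -> hcut C i = 1%N)
         /\ exists a : int, thin_form (A ^ a) al be si ta be' si' ta'
                        \/ thin_form (A ^ a) be al ta si al' ta' si'].

Lemma split_value_left al be ta :
  split_value (A * al) (A * be) (A * (dd * ta + be)) (A * ta)
  = A ^+ 2 * ((dd ^+ 2 - 1) * ta + al + dd * be).
Proof. by rewrite /split_value; field. Qed.

Lemma split_value_right al be si :
  split_value (A^-1 * al) (A^-1 * be) (A^-1 * si) (A^-1 * (dd * si + al))
  = A^-1 ^+ 2 * ((dd ^+ 2 - 1) * si + be + dd * al).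
Proof. by rewrite /split_value; field. Qed.

(** The factor [dd^2 - 1] telescopes the geometric sum and the extra term cancels the remainder;
    this is why split values are products. *)
Lemma geom_split z c : (dd ^+ 2 - 1) * (z * geom c) + z = z * dd ^+ (2 * c).
Proof. by rewrite mulrCA geomE; ring. Qed.

Lemma geom_split_dd z c :
  (dd ^+ 2 - 1) * (z * (dd * geom c)) + dd * z = z * (dd * dd ^+ (2 * c)).
Proof.
transitivity (z * (dd * ((dd ^+ 2 - 1) * geom c)) + dd * z); first by ring.
by rewrite geomE; ring.
Qed.

Let form_exp a := product_form_exp a.
Let form_dd_exp n : product_form (dd ^+ n) := product_formX n product_form_dd.

Lemma tail_left (j : 'I_m) u : one_cut C j u -> C u = yright j ->
  tail_values j.+1 (yleft j) -> tail_values j u.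
Proof.
move=> cut Cu [al [be [si [ta [al' [be' [si' [ta' [cv cn fsplit tl]]]]]]]]].
have [hu _] := cut.
have {}cv := val_left hu Cu cv.
have {}cn := cut_values_left C_mat hu Cu cn.
do 8!eexists; split; [exact: cv | exact: cn | |].
  rewrite split_value_left; apply: product_formM; first exact: (form_exp 2).
  case: tl => [[i [_ _ [-> ->] _ fta]]|[_ [a [|]]]].
  - rewrite mulr0 !addr0; exact: product_formM product_form_dd1 fta.
  - move=> [c [e [-> -> _ -> _]]]; rewrite mulr0 addr0 geom_split.
    exact: product_formM.
  move=> [c [e [-> -> -> _ _]]]; rewrite addr0 geom_split_dd.
  by apply: product_formM => //; apply: product_formM => //; apply: product_form_dd.
case: tl => [[i [im hi [-> ->] fsi fta]]|[one [a tf]]].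
  left; exists i; split; rewrite ?mulr0 ?addr0 //.
    by apply: product_formA; apply: product_formM product_form_dd fta.
  exact: product_formA.
right; split=> [i /andP[]|].
  rewrite leq_eqVlt => /predU1P[<- _|lt_ji le_im]; first exact: hcut_one cut.
  by apply: one; rewrite lt_ji.
exists (1 + a); rewrite expfzDr // expr1z; case: tf.
  (* Bottom return on the left: beta vanishes, so the new sigma is [dd] times tau and both sums get
     length [e]. *)
  move=> [c [e [-> -> _ -> [_ h0]]]]; left; exists e, e; split.
  - by [].
  - by rewrite mulr0.
  - by rewrite addr0; ring.
  - by rewrite mulrA.
  by split=> /h0[-> ->].
(* Bottom return on the right: up to a power of [A] the new sigma is [dd^2 geom c + 1], a sum with
   one more term. *)
move=> [c [e [-> -> -> _ [h0 _]]]]; right; exists c, c.+1; split.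
- by [].
- by rewrite mulr0.
- by rewrite mulrA.
- by rewrite geomS; ring.
by split=> // /h0 ->.
Qed.

Lemma tail_right (j : 'I_m) u : one_cut C j u -> C u = yleft j ->
  tail_values j.+1 (yright j) -> tail_values j u.
Proof.
move=> cut Cu [al [be [si [ta [al' [be' [si' [ta' [cv cn fsplit tl]]]]]]]]].
have [hu _] := cut.
have {}cv := val_right hu Cu cv.
have {}cn := cut_values_right C_mat hu Cu cn.
do 8!eexists; split; [exact: cv | exact: cn | |].
  rewrite split_value_right; apply: product_formM.
    exact: (product_formX 2 (form_exp (-1))).
  case: tl => [[i [_ _ [-> ->] fsi _]]|[_ [a [|]]]].
  - rewrite mulr0 !addr0; exact: product_formM product_form_dd1 fsi.
  - move=> [c [e [-> -> -> _ _]]]; rewrite addr0 geom_split_dd.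
    by apply: product_formM => //; apply: product_formM => //; apply: product_form_dd.
  move=> [c [e [-> -> _ -> _]]]; rewrite mulr0 addr0 geom_split.
  exact: product_formM.
case: tl => [[i [im hi [-> ->] fsi fta]]|[one [a tf]]].
  left; exists i; split; rewrite ?mulr0 ?addr0 //.
    exact: product_formV.
  by apply: product_formV; apply: product_formM product_form_dd fsi.
right; split=> [i /andP[]|].
  rewrite leq_eqVlt => /predU1P[<- _|lt_ji le_im]; first exact: hcut_one cut.
  by apply: one; rewrite lt_ji.
exists (-1 + a); rewrite expfzDr // exprN1; case: tf.
  move=> [c [e [-> -> -> _ [h0 _]]]]; left; exists c, c.+1; split.
  - by [].
  - by rewrite mulr0.
  - by rewrite mulrA.
  - by rewrite geomS; ring.
  by split=> // /h0 ->.
move=> [c [e [-> -> _ -> [_ h0]]]]; right; exists e, e; split.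
- by [].
- by rewrite mulr0.
- by rewrite addr0; ring.
- by rewrite mulrA.
by split=> /h0[-> ->].
Qed.

Lemma tail_spread (j : 'I_m) u : one_cut C j u -> above j.+1 (C u) = false ->
    three_cuts C j.+1 (yleft j) u (yright j) ->
    product_form (val j.+1 (Through (yleft j) u (yright j))) ->
  tail_values j u.
Proof.
move=> [hu _] Cu cut3; move e: (val _ _) => w fw.
have cv := val_spread hu Cu e.
have cn := cut_values_spread C_mat (1 : nat) (1 : nat) (1 : nat) hu Cu.
do 8!eexists; split; [exact: cv | exact: cn | |].
  (* The weights [A^3 A^-1] and [A^-3 A] add up to [dd]. *)
  have -> : split_value 0 0 (A^-1 * w) (A * w) = dd * w.
    by rewrite /split_value; field.
  exact: product_formM product_form_dd fw.
left; exists j.+1; split=> //; first exact: hcut_three cut3.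
  exact: product_formV.
exact: product_formA.
Qed.

Lemma tail_bottom u : one_cut C m u -> tail_values m u.
Proof.
move=> cut; have [] := one_cut_bottom CatC cut => -[e1 e2].
  have cv := cut_values_end_left C_mat A A^-1 (- A ^+ 2 - A ^- 2) e1 e2.
  have cn := cut_values_end_left C_mat (1 : nat) (1 : nat) (1 : nat) e1 e2.
  do 8!eexists; split; [exact: cv | exact: cn | |].
    by rewrite /split_value !mulr0 mulr1 !add0r addr0; apply: (form_exp 1).
  right; split=> [i|]; first by rewrite -eqn_leq => /eqP <-; apply: hcut_one cut.
  (* With no row left sigma and tau are 0, so both sums are empty. *)
  exists 0; left; exists 0%N, 0%N.
  by rewrite geom0 expr0z !mulr0.
have cv := cut_values_end_right C_mat A A^-1 (- A ^+ 2 - A ^- 2) e1 e2.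
have cn := cut_values_end_right C_mat (1 : nat) (1 : nat) (1 : nat) e1 e2.
do 8!eexists; split; [exact: cv | exact: cn | |].
  by rewrite /split_value !mulr0 mulr1 !add0r; apply: (form_exp (-1)).
right; split=> [i|]; first by rewrite -eqn_leq => /eqP <-; apply: hcut_one cut.
exists 0; right; exists 0%N, 0%N.
by rewrite geom0 expr0z !mulr0.
Qed.

(** Downward induction on the level; the claims are proved together because one cut can be followed
    by three and three by one. *)
Lemma tail_induction k : (k <= m)%N ->
  (forall u, one_cut C k u -> tail_values k u)
  /\ forall s1 s2 s3, three_cuts C k s1 s2 s3 ->
       product_form (val k (Through s1 s2 s3)).
Proof.
move/subnKC; move: (m - k)%N => d; elim: d k => [|d IH] k.
  rewrite addn0 => ->; split=> [u|s1 s2 s3 cut]; first exact: tail_bottom.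
  have [e1 e2 e3] := three_cuts_bottom CatC cut.
  rewrite value_top //; exact: product_form1.
rewrite addnS => e; have lt_km : (k < m)%N by rewrite -e ltnS leq_addr.
have [] := IH k.+1 e; rewrite -[k]/(Ordinal lt_km : nat).
move: (Ordinal lt_km) => j {e lt_km} IH1 IH3; split=> [u cut | s1 s2 s3 cut].
  case: (one_cut_step CatC cut) => [[Cu /IH1]|[Cu /IH1]|[Cu cut3]].
  - exact: tail_left.
  - exact: tail_right.
  exact: tail_spread (IH3 _ _ _ cut3).
have [[h1 h2 h3] _ _] := cut.
case: (three_cuts_step CatC real_C cut)
  => [[C1 C3 C2 cut1]|[C1 C2 C3 cut3]|[C3 C1 C2 cut3]].
- have [al [be [si [ta [? [? [? [? [cv _ fsplit _]]]]]]]]] := IH1 _ cut1.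
  rewrite (value_cut C_mat h1 h2 h3 C1 C3 C2 cv).
  have <- : split_value al be si ta = A ^+ 3 * si + A^-1 ^+ 3 * ta
      + A ^+ 2 * A^-1 * al + A * A^-1 ^+ 2 * be by rewrite /split_value; field.
  exact: fsplit.
- rewrite (value_left _ _ _ h1 h2 h3 C1 C2 C3).
  by apply: product_formM (IH3 _ _ _ cut3); apply: (product_formX 3 (form_exp (-1))).
rewrite (value_right _ _ _ h1 h2 h3 C3 C1 C2).
by apply: product_formM (IH3 _ _ _ cut3); apply: (form_exp 3).
Qed.

Lemma at_level_top :
  at_level C 0 lines (Through (xtop column0) (xtop column1) (xtop column2)) [::].
Proof.
split=> //.
- exact: lines_matching.
- by split=> // z; rewrite !inE => /or3P[] /eqP ->.
case=> [[i|//]|[]] //= _; case/negP.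
by case: i => [[|[|[|]]]] // lt; rewrite !inE -!(inj_eq val_inj).
Qed.

Lemma skein_top (R : comNzSemiRingType) (p q dl : R) :
  skein p q dl C (crossings_from 0) lines
  = value C p q dl (drop 0 (enum 'I_m))
      (Through (xtop column0) (xtop column1) (xtop column2)).
Proof. exact: (skein_value C_mat p q dl (leq0n m) at_level_top). Qed.

(** At weights 1 the expansion counts the states realizing [C]; this will exclude empty geometric
    sums. *)
Lemma count_top :
  count 0 (Through (xtop column0) (xtop column1) (xtop column2)) <> 0%N.
Proof.
rewrite -skein_top -skein_crossings; have /existsP[s sC] := real_C.
by rewrite (bigD1 s) //= !expr1n.
Qed.

(** With three cuts at the top the product form is immediate. Otherwise the return of [C] on the top
    side selects sigma or tau at level 0, and the alternative in [tail_values] decides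
    decomposability. *)
Lemma skein_forms :
  let x := skein A A^-1 (- A ^+ 2 - A ^- 2) C (crossings_from 0) lines in
  (vertically_decomposable C -> product_form x)
  /\ (~~ vertically_decomposable C -> exists (a : int) (b c : nat),
      [/\ b \in [:: 0; 1]%N, (1 <= c)%N & x = A ^ a * dd ^+ b * geom c]).
Proof.
rewrite /= skein_top.
have [IH1 IH3] := tail_induction (leq0n m).
have dec i : (i <= m)%N -> hcut C i = 3%N -> vertically_decomposable C.
  by move=> le_im hi; apply/existsP; exists (Ordinal (n:=m.+1) (m:=i) le_im); apply/eqP.
have undec : (forall i, (0 <= i <= m)%N -> hcut C i = 1%N) ->
    ~~ vertically_decomposable C.
  by move=> one; apply/existsP => -[i /eqP]; rewrite one // (leq_ord i).
have nz := count_top.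
case: (top_cuts CatC) => [cut | [C01 cut] | [C12 cut]].
- split=> [_ | /negP[]]; first exact: IH3 cut.
  by apply: (dec 0%N) => //; apply: hcut_three cut.
- have [al [be [si [ta [al' [be' [si' [ta' [cv cn _ tl]]]]]]]]] := IH1 _ cut.
  have [_ _ /(_ (xtop column0) (xtop column1) isT isT C01) -> _] := cv.
  have [_ _ /(_ (xtop column0) (xtop column1) isT isT C01) e' _] := cn; rewrite e' in nz.
  case: tl => [[i [im hi _ fsi _]]|[one [a tf]]].
    by split=> // /negP[]; apply: dec hi.
  split=> [/(negP (undec one))//|_].
  (* An empty sum would make the number of realizing states zero, so the sum has at least one
     term. *)
  case: tf => [[c [e [_ _ -> _ [h0 _]]]] | [c [e [_ _ _ -> [_ h0]]]]].
    exists a, 1%N, c; rewrite expr1 mulrA; split=> //.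
    by case: c h0 => // /(_ erefl).
  exists a, 0%N, e; rewrite expr0 mulr1; split=> //.
  by case: e h0 => // /(_ erefl)[].
have [al [be [si [ta [al' [be' [si' [ta' [cv cn _ tl]]]]]]]]] := IH1 _ cut.
have [_ _ _ /(_ (xtop column1) (xtop column2) isT isT C12) ->] := cv.
have [_ _ _ /(_ (xtop column1) (xtop column2) isT isT C12) e'] := cn; rewrite e' in nz.
case: tl => [[i [im hi _ _ fta]]|[one [a tf]]].
  by split=> // /negP[]; apply: dec hi.
split=> [/(negP (undec one))//|_].
case: tf => [[c [e [_ _ _ -> [_ h0]]]] | [c [e [_ _ -> _ [h0 _]]]]].
  exists a, 0%N, e; rewrite expr0 mulr1; split=> //.
  by case: e h0 => // /(_ erefl)[].
exists a, 1%N, c; rewrite expr1 mulrA; split=> //.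
by case: c h0 => // /(_ erefl).
Qed.

Theorem skein_closed_forms (A4_neq0 : A ^- 4 + 1 + A ^+ 4 != 0) :
  let x := skein A A^-1 (- A ^+ 2 - A ^- 2) C (crossings_from 0) lines in
  (vertically_decomposable C -> exists (a : int) (b c : nat),
     x = A ^ a * dd ^+ b * (A ^- 4 + 1 + A ^+ 4) ^+ c)
  /\ (~~ vertically_decomposable C -> exists (a : int) (b c : nat),
      [/\ b \in [:: 0; 1]%N, (1 <= c)%N
        & x = A ^ a * dd ^+ b
              * ((dd ^+ (2 * c) - 1) / (A ^- 4 + 1 + A ^+ 4))]).
Proof.
have [dec undec] := skein_forms; rewrite -dd_sqrB1 in A4_neq0 *.
split=> // /undec[a [b [c [b01 c_gt0 ->]]]]; exists a, b, c; split=> //.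
by congr (_ * _); rewrite -geomE mulrAC mulfV // mul1r.
Qed.

End Invariant.

(** * The coefficient in the fraction field *)

Lemma A_neq0 : A != 0.
Proof. by rewrite tofrac_eq0 polyX_eq0. Qed.

(** Multiplication by [A^4] gives the image of the polynomial [X^8 + X^4 + 1], whose value at 0 is
    1. *)
Lemma denominator_neq0 : A ^- 4 + 1 + A ^+ 4 != 0.
Proof.
apply/eqP => e; have := clear_denominators A_neq0; rewrite e mulr0 => /esym/eqP.
have -> : A ^+ 8 + A ^+ 4 + 1 = tofrac ('X^8 + 'X^4 + 1).
  by rewrite !tofracD !tofracXn tofrac1.
rewrite tofrac_eq0 => /eqP/(congr1 (fun r : {poly int} => r.[0])).
by rewrite !hornerE.
Qed.

Lemma coefficientE (m n : nat) (C : {ffun bpoint m n -> bpoint m n}) :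
  coefficient C = skein A A^-1 (- A ^+ 2 - A ^- 2) C (crossings_from 0) lines.
Proof.
rewrite -skein_crossings /coefficient; apply: eq_bigr => s _.
by rewrite expfzDr ?A_neq0 // -exprz_inv -!exprnP.
Qed.

Theorem corollary4p18 (m : nat) (C : {ffun bpoint m 3 -> bpoint m 3})
    (hC : C \in Cat m 3) (hreal : realizable C) :
  (vertically_decomposable C ->
     exists (a : int) (b c : nat),
       coefficient C
       = A ^ a * (A ^- 2 + A ^+ 2) ^+ b * (A ^- 4 + 1 + A ^+ 4) ^+ c)
  /\
  (~~ vertically_decomposable C ->
     exists (a : int) (b c : nat),
       [/\ b \in [:: 0; 1]%N, (1 <= c)%N
         & coefficient C
           = A ^ a * (A ^- 2 + A ^+ 2) ^+ b
             * (((A ^- 2 + A ^+ 2) ^+ (2 * c) - 1) / (A ^- 4 + 1 + A ^+ 4))]).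
Proof.
rewrite coefficientE.
exact: (skein_closed_forms hC hreal A_neq0 denominator_neq0).
Qed.
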